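(* The space $\mathcal{D}(2)$ of Delzant polygons in $\mathbb{R}^2$ is simply connected.
   Context: A Delzant polygon is a full-dimensional convex polygon in $\mathbb{R}^2$ with rational edge directions such that at each vertex the two primitive integer vectors along the edges form a basis of $\mathbb{Z}^2$. $\mathcal{D}(2)$ is the set of Delzant polygons with the topology induced by the Hausdorff distance, equivalently by the symmetric difference distance $\delta^V(P,Q)=\mathrm{Vol}(P\setminus Q)+\mathrm{Vol}(Q\setminus P)$. *)

(* Defs.v *)
From HB Require Import structures.
From mathcomp Require Import all_boot all_order all_algebra ring lra.
From mathcomp Require Import all_classical all_reals all_analysis homotopy.
Set Implicit Arguments.
Unset Strict Implicit.
Unset Printing Implicit Defensive.
Import Order.TTheory GRing.Theory Num.Theory.
Import numFieldNormedType.Exports.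
Local Open Scope classical_set_scope.
Local Open Scope ring_scope.

Section SimplyConnected.
Variable R : realType.

Definition unit_interval : Type := set_type `[0 : R, 1]%classic.

HB.instance Definition _ := Topological.on unit_interval.

Let zero_in : (0 : R) \in `[0 : R, 1]%classic.
Proof. by rewrite inE /= in_itv /= lexx ler01. Qed.

Let one_in : (1 : R) \in `[0 : R, 1]%classic.
Proof. by rewrite inE /= in_itv /= lexx ler01. Qed.

Let I0 : unit_interval := exist _ 0 zero_in.
Let I1 : unit_interval := exist _ 1 one_in.

Let I0_neq_I1 : I0 != I1.
Proof. by apply/eqP => /(congr1 val) /= /eqP; rewrite eq_sym oner_eq0. Qed.

HB.instance Definition _ := isBiPointed.Build unit_interval I0_neq_I1.

Local Notation I := unit_interval.

Definition path_connected (T : topologicalType) : Prop :=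
  [set: T] !=set0 /\ forall x y : T, inhabited {path I from x to y in T}.

Definition path_homotopic (T : topologicalType) (x y : T)
    (f g : {path I from x to y in T}) : Prop :=
  exists H : I * I -> T,
    [/\ continuous H,
        forall s, H (s, zero) = f s,
        forall s, H (s, one) = g s &
        forall t, H (zero, t) = x /\ H (one, t) = y].

Definition simply_connected (T : topologicalType) : Prop :=
  path_connected T /\
  forall (x : T) (f : {path I from x to x in T}),
    path_homotopic f (cst x : {path I from x to x in T}).

End SimplyConnected.

Section Polygons.
Variable R : realType.

Local Notation plane := 'rV[R]_2.
Implicit Types (A P E F V : set plane) (u v w : 'rV[int]_2) (x y : plane).

Definition convex_hull A : set plane := smallest (@convex_set R plane) A.

Definition convex_polytope P : Prop :=
  exists2 V, finite_set V & P = convex_hull V.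

(* The dimension of a nonempty set is that of its affine hull, whose direction
   is the linear span of the differences of points of the set. *)
Definition has_dim (d : nat) A : Prop :=
  A !=set0 /\
  exists U : {vspace plane},
    [/\ \dim U = d,
        forall x y, A x -> A y -> x - y \in U &
        forall W : {vspace plane},
          (forall x y, A x -> A y -> x - y \in W) -> (U <= W)%VS].

Definition dot x y : R := \sum_i x ord0 i * y ord0 i.

Definition face P F : Prop :=
  exists c : plane, F = [set x | P x /\ forall y, P y -> dot c y <= dot c x].

Definition edge P E : Prop := face P E /\ has_dim 1 E.

Definition vertex P x : Prop := face P [set x].

Definition rational_direction E : Prop :=
  exists2 q : 'rV[rat]_2, q != 0 &
    forall x y, E x -> E y -> exists t : R, x - y = t *: map_mx ratr q.

Definition primitive u : Prop := coprimez (u ord0 0) (u ord0 1).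

Definition primitive_edge_vector P x u : Prop :=
  primitive u /\
  exists E, [/\ edge P E, E x &
    exists2 t : R, 0 < t & E (x + t *: map_mx intr u)].

Definition Z2_basis u v : Prop :=
  forall w, exists! ab : int * int, w = ab.1 *: u + ab.2 *: v.

Definition is_delzant P : Prop :=
  [/\ convex_polytope P,
      has_dim 2 P,
      forall E, edge P E -> rational_direction E &
      forall x, vertex P x -> exists u v,
        Z2_basis u v /\ primitive_edge_vector P x = [set u; v]].

Record delzant_polygon : Type := DelzantPolygon {
  polygon_set :> set plane;
  polygon_setP : is_delzant polygon_set
}.

(* The library norm on 'rV_2 is the sup norm, hence the explicit formula. *)
Definition euclid_dist x y : R :=
  Num.sqrt ((x ord0 0 - y ord0 0) ^+ 2 + (x ord0 1 - y ord0 1) ^+ 2).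

Definition within_dist (e : R) A B : Prop :=
  forall x, A x -> exists2 y, B y & euclid_dist x y <= e.

Definition hausdorff_dist A B : R :=
  inf [set e : R | [/\ 0 <= e, within_dist e A B & within_dist e B A]].

End Polygons.

Section HausdorffMetric.
Variable R : realType.
Local Notation plane := 'rV[R]_2.
Local Notation delzant := (delzant_polygon R).
Implicit Types (A B C : set plane) (x y z p : plane) (P Q : delzant).

Lemma euclid_distxx x : euclid_dist x x = 0.
Proof. by rewrite /euclid_dist !subrr expr0n addr0 sqrtr0. Qed.

Lemma euclid_distC x y : euclid_dist x y = euclid_dist y x.
Proof. by rewrite /euclid_dist; congr Num.sqrt; ring. Qed.

Lemma euclid_dist_triangle y x z :
  euclid_dist x z <= euclid_dist x y + euclid_dist y z.
Proof.
have nonneg (a b : R) : 0 <= a ^+ 2 + b ^+ 2 by rewrite addr_ge0 ?sqr_ge0.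
rewrite /euclid_dist.
set a := x ord0 0 - y ord0 0; set b := x ord0 1 - y ord0 1.
set c := y ord0 0 - z ord0 0; set d := y ord0 1 - z ord0 1.
have -> : x ord0 0 - z ord0 0 = a + c by rewrite /a /c; ring.
have -> : x ord0 1 - z ord0 1 = b + d by rewrite /b /d; ring.
set s := Num.sqrt (a ^+ 2 + b ^+ 2); set t := Num.sqrt (c ^+ 2 + d ^+ 2).
have s0 : 0 <= s by exact: sqrtr_ge0.
have t0 : 0 <= t by exact: sqrtr_ge0.
have s2 : s ^+ 2 = a ^+ 2 + b ^+ 2 by rewrite sqr_sqrtr.
have t2 : t ^+ 2 = c ^+ 2 + d ^+ 2 by rewrite sqr_sqrtr.
have cs : a * c + b * d <= s * t.
  apply: (le_trans (ler_norm _)).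
  rewrite -(@ler_pXn2r _ 2%N) // ?nnegrE ?mulr_ge0 // real_normK ?num_real //.
  rewrite exprMn s2 t2; have := sqr_ge0 (a * d - b * c); lra.
rewrite -[leRHS]ger0_norm ?addr_ge0 // -sqrtr_sqr ler_wsqrtr //.
have -> : (s + t) ^+ 2 = s ^+ 2 + t ^+ 2 + 2 * (s * t) by ring.
rewrite s2 t2; lra.
Qed.

Lemma norm_le_euclid_dist x y : `|x - y| <= euclid_dist x y.
Proof.
have nonneg (a b : R) : 0 <= a ^+ 2 + b ^+ 2 by rewrite addr_ge0 ?sqr_ge0.
rewrite [leLHS]mx_normrE; apply/bigmax_leP; split => [|[i j] _] /=.
  exact: sqrtr_ge0.
rewrite ord1 !mxE -sqrtr_sqr ler_wsqrtr //.
case: j => [[|[|//]]] jlt /=.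
- by rewrite (_ : Ordinal jlt = 0) ?lerDl ?sqr_ge0 //; apply: val_inj.
- by rewrite (_ : Ordinal jlt = 1) ?lerDr ?sqr_ge0 //; apply: val_inj.
Qed.

Lemma euclid_dist_le_norm x y : euclid_dist x y <= 2 * `|x - y|.
Proof.
have le_norm i : `|x ord0 i - y ord0 i| <= `|x - y|.
  rewrite [leRHS]mx_normrE.
  have := @le_bigmax _ _ _ (0 : R)
    (fun ij : 'I_1 * 'I_2 => `|(x - y) ij.1 ij.2|) (ord0, i).
  by rewrite /= !mxE.
rewrite -[leRHS]ger0_norm ?mulr_ge0 // -sqrtr_sqr ler_wsqrtr //.
have sq i : (x ord0 i - y ord0 i) ^+ 2 <= `|x - y| ^+ 2.
  rewrite -[_ ^+ 2]real_normK ?num_real //.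
  by rewrite ler_pXn2r // nnegrE.
have := sq 0; have := sq 1; have := sqr_ge0 `|x - y|; lra.
Qed.

Lemma convex_setP A : @convex_set R plane A <->
  forall x y (t : R), A x -> A y -> 0 <= t -> t <= 1 ->
    A (t *: x + (1 - t) *: y).
Proof.
split=> [cA x y t Ax Ay t0 t1|cA x y t]; last first.
  rewrite !inE => Ax Ay; exact: (cA _ _ _ Ax Ay).
by have := cA x y (Itv01 t0 t1); rewrite !inE; apply.
Qed.

Lemma convex_hull_convex A : @convex_set R plane (convex_hull A).
Proof.
apply/convex_setP => x y t Ax Ay t0 t1 B [cB AB].
by apply: (convex_setP B).1 => //; [apply: Ax|apply: Ay].
Qed.

Lemma convex_join A p : A !=set0 -> @convex_set R plane A ->
  @convex_set R plane [set z | exists2 sa : R * plane,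
    (`[0, 1]%classic `*` A) sa & sa.1 *: p + (1 - sa.1) *: sa.2 = z].
Proof.
move=> [a0 Aa0] /convex_setP cA.
apply/convex_setP => x y t [[s1 a1] /= [/[!in_itv]/= /andP[s10 s11] Aa1] <-].
case=> [[s2 a2] /= [/[!in_itv]/= /andP[s20 s21] Aa2] <-] t0 t1.
set s := t * s1 + (1 - t) * s2.
set k1 := t * (1 - s1); set k2 := (1 - t) * (1 - s2).
have k10 : 0 <= k1 by rewrite mulr_ge0 ?subr_ge0.
have k20 : 0 <= k2 by rewrite mulr_ge0 ?subr_ge0.
have sE : 1 - s = k1 + k2 by rewrite /s /k1 /k2; ring.
have s0 : 0 <= s by rewrite addr_ge0 ?mulr_ge0 ?subr_ge0.
have s1' : s <= 1 by rewrite -subr_ge0 sE addr_ge0.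
have -> : t *: (s1 *: p + (1 - s1) *: a1) +
    (1 - t) *: (s2 *: p + (1 - s2) *: a2) = s *: p + (k1 *: a1 + k2 *: a2).
  by apply/rowP => i; rewrite !mxE /s /k1 /k2; ring.
have [k0|k0] := eqVneq (k1 + k2) 0.
  have/andP[/eqP -> /eqP ->] : (k1 == 0) && (k2 == 0).
    by rewrite -paddr_eq0 ?k0 ?eqxx.
  exists (s, a0); last by rewrite /= sE k0 !scale0r !addr0.
  by split=> //=; rewrite in_itv /= s0 s1'.
have kgt0 : 0 < k1 + k2 by rewrite lt_neqAle eq_sym k0 addr_ge0.
exists (s, (k1 / (k1 + k2)) *: a1 + (1 - k1 / (k1 + k2)) *: a2).
  split; first by rewrite /= in_itv /= s0 s1'.
  apply: cA => //; first by rewrite divr_ge0 // ltW.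
  by rewrite ler_pdivrMr // mul1r lerDl.
congr (_ + _); rewrite sE scalerDr !scalerA; congr (_ *: _ + _ *: _); field;
  exact: k0.
Qed.

Lemma compact_convex_hull_seq (s : seq plane) :
  compact (convex_hull [set` s]).
Proof.
elim: s => [|p s IHs].
  have -> : convex_hull [set` ([::] : seq plane)] = set0 :> set plane.
    rewrite /convex_hull set_nil; apply: smallest_id.
    by apply/convex_setP.
  exact: compact0.
have [s0|s0] := eqVneq s [::].
  have -> : convex_hull [set` p :: s] = [set p].
    rewrite s0 /convex_hull set_cons1; apply: smallest_id.
    apply/convex_setP => x y t /= -> -> _ _.
    by rewrite -scalerDl addrC subrK scale1r.
  exact: compact_set1.
pose K := convex_hull [set` s].
have sK : [set` s] `<=` K by exact: sub_gen_smallest.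
have K0 : K !=set0.
  by exists (head p s); apply: sK; case: (s) s0 => // q s' _; exact: mem_head.
have -> : convex_hull [set` p :: s] =
    (fun sa : R * plane => sa.1 *: p + (1 - sa.1) *: sa.2) @`
      (`[0, 1]%classic `*` K).
  apply/seteqP; split.
    apply: smallest_sub.
      exact: convex_join K0 (@convex_hull_convex _).
    move=> q /=; rewrite inE => /orP[/eqP ->|qs].
      case: K0 => a Ka; exists (1, a) => /=.
        by split; rewrite //= in_itv /= ler01 lexx.
      by rewrite subrr scale0r scale1r addr0.
    exists (0, q) => /=; last by rewrite subr0 scale0r scale1r add0r.
    by split; [rewrite /= in_itv /= lexx ler01|exact: sK].
  move=> _ [[t a] [/= /[!in_itv]/= /andP[t0 t1] Ka] <-] B [cB sB] /=.
  apply: (convex_setP B).1 => //; first by apply: sB; exact: mem_head.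
  apply: Ka; split=> // q qs; apply: sB => /=.
  by rewrite inE qs orbT.
apply: continuous_compact.
  apply: continuous_subspaceT => -[t a].
  apply: (@cvgD _ plane).
    apply: cvgZ; [exact: cvg_fst|exact: cvg_cst].
  apply: cvgZ; last exact: cvg_snd.
  by apply: cvgB; [exact: cvg_cst|exact: cvg_fst].
apply: compact_setX => //; exact: segment_compact.
Qed.

Lemma convex_polytope_compact A : convex_polytope A -> compact A.
Proof.
case=> V /finite_seqP[s ->] ->; exact: compact_convex_hull_seq.
Qed.

Lemma delzant_compact P : compact (P : set plane).
Proof. by case: P => A HA /=; case: HA => /convex_polytope_compact. Qed.

Lemma delzant_nonempty P : (P : set plane) !=set0.
Proof. by case: P => A HA /=; case: HA => _ []. Qed.

Local Notation dset A B :=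
  [set e : R | [/\ 0 <= e, within_dist e A B & within_dist e B A]].

Let dset_lb A B : has_lbound (dset A B).
Proof. by exists 0 => e []. Qed.

Let dset_nonempty P Q : dset (polygon_set P) (polygon_set Q) !=set0.
Proof.
have bnd P' : exists M : R, forall x, (P' : set plane) x -> `|x| <= M.
  have [M [_ HM]] := compact_bounded (@delzant_compact P').
  by exists (M + 1) => x; apply: HM; rewrite ltrDl.
have [M HM] := bnd P; have [N HN] := bnd Q.
have [[x0 Px0] [y0 Qy0]] := (delzant_nonempty P, delzant_nonempty Q).
have MN x y : (P : set plane) x -> (Q : set plane) y ->
    euclid_dist x y <= 2 * (M + N).
  move=> Px Qy; apply: le_trans (euclid_dist_le_norm _ _) _.
  rewrite ler_pM2l // (le_trans (ler_normB _ _)) // lerD //.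
    exact: HM.
  exact: HN.
exists (2 * (M + N)); split.
- by apply: le_trans (MN _ _ Px0 Qy0); exact: sqrtr_ge0.
- by move=> x Px; exists y0 => //; exact: MN.
- by move=> y Qy; exists x0 => //; rewrite euclid_distC; exact: MN.
Qed.

Let hdist P Q : R := hausdorff_dist (polygon_set P) (polygon_set Q).

Let hdistC P Q : hdist P Q = hdist Q P.
Proof. by congr inf; apply/seteqP; split => e []. Qed.

Let hdistxx P : hdist P P = 0.
Proof.
apply/le_anti/andP; split.
  apply: ge_inf => //; split => // x Px; exists x => //;
    by rewrite euclid_distxx.
by apply: lb_le_inf => // e [].
Qed.

Let hdist_triangle Q P S : hdist P S <= hdist P Q + hdist Q S.
Proof.
have wD e1 e2 A B C : within_dist e1 A B -> within_dist e2 B C ->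
    within_dist (e1 + e2) A C.
  move=> AB BC x /AB[y /BC[z Cz yz] xy]; exists z => //.
  by rewrite (le_trans (euclid_dist_triangle y _ _)) // lerD.
rewrite -lerBlDr; apply: lb_le_inf => // e1 [e10 PQ QP].
rewrite lerBlDr addrC -lerBlDr; apply: lb_le_inf => // e2 [e20 QS SQ].
rewrite lerBlDr; apply: ge_inf => //; split; first exact: addr_ge0.
- by rewrite addrC; exact: wD PQ QS.
- exact: wD SQ QP.
Qed.

Let hdist_positivity P Q : hdist P Q = 0 -> P = Q.
Proof.
have sub P' Q' : hdist P' Q' = 0 ->
    (P' : set plane) `<=` (Q' : set plane).
  move=> d0 x Px.
  apply: (compact_closed (@norm_hausdorff _ _) (@delzant_compact Q')) => U.
  move/nbhs_ballP => [e e0 eU].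
  have [|d [_ PQ _] de] := @inf_lt _ _ e (dset_nonempty P' Q').
    by rewrite [inf _]d0.
  have [y Qy xy] := PQ x Px; exists y; split => //; apply: eU.
  rewrite -ball_normE /=.
  exact: le_lt_trans (norm_le_euclid_dist _ _) (le_lt_trans xy de).
move=> d0; have PQ : P = Q :> set plane.
  by apply/seteqP; split; apply: sub; rewrite // hdistC.
case: P Q PQ {d0} => [A HA] [B HB] /= AB; case: _ / AB HB => HB.
by congr DelzantPolygon; exact: Prop_irrelevance.
Qed.

HB.instance Definition _ := gen_eqMixin delzant.
HB.instance Definition _ := gen_choiceMixin delzant.
HB.instance Definition _ := @isMetric.Build R delzant
  hdist hdistxx hdist_positivity hdistC hdist_triangle.

End HausdorffMetric.

(* Main.v *)
Require Import Defs.
From HB Require Import structures.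
From mathcomp Require Import all_boot all_order all_algebra.
From mathcomp Require Import all_classical all_reals all_analysis homotopy.
From mathcomp Require Import ring lra zify.
Set Implicit Arguments.
Unset Strict Implicit.
Unset Printing Implicit Defensive.
Import Order.TTheory GRing.Theory Num.Theory.
Import numFieldNormedType.Exports.
Local Open Scope classical_set_scope.
Local Open Scope ring_scope.

(** The space is in fact contractible, by an explicit deformation onto any chosen
    polygon P0 that keeps P0 fixed.

    Convex bodies are contracted to P0 by the Minkowski segment
    (1 - s) P + s P0, but this leaves the Delzant polygons: the normal fan of a
    Minkowski sum is the common refinement of two fans, and a common refinement
    of smooth fans need not be smooth.  The remedy is to push every convex body K
    back among the Delzant polygons by an approximation Phi (K, lam), lam > 0,
    which is continuous in both arguments and tends to K as lam tends to 0.

    Start from the fan of the four quadrants and subdivide each cone (u, v) into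
    (u, u + v) and (u + v, v), over and over.  This gives smooth complete fans,
    each refining the one before it, whose directions become dense.  Let A_n be
    the polygon circumscribed about K + lam B, B the unit disc, with edge normals
    the rays of the n-th fan.  The support function of K + lam B is strictly
    convex, so every edge of A_n has positive length, the normal fan of A_n is
    exactly the n-th fan, and A_n is Delzant.  The segment (1 - t) A_n + t A_(n+1)
    has as its normal fan the finer of two nested smooth fans, so it stays Delzant.
    Running through A_0, A_1, A_2, ... at time 1 / lam defines Phi (K, lam).  At
    level n the vertices of A_n are within diam K / n + 2 lam of K, which gives the
    convergence to K.

    The contraction sends (P, s) to Phi ((1 - s) P + s P0, lam) with
    lam = s (1 - s) d(P, P0), and Phi (K, 0) = K.  The radius lam vanishes only
    where the Minkowski segment is P (at s = 0) or P0 (at s = 1 or P = P0), so every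
    value is a Delzant polygon.  The point P0 never moves; hence the loops based at P0 contract with fixed base point,
    and P is joined to P0 by s |-> contraction (P, s).

    The lemmas that carry the proof are smooth_family_delzant (vertices indexed by
    the cones of a smooth complete fan span a Delzant polygon),
    level_vertex_family (the segments above are of that kind), approx_near (the
    rate of approximation) and contraction_continuous. *)

(** * Smooth fans obtained by repeated subdivision of the quadrants *)

Definition ivec : Type := (int * int)%type.

Definition cross (u v : ivec) : int := u.1 * v.2 - u.2 * v.1.

Definition inner (u v : ivec) : int := u.1 * v.1 + u.2 * v.2.

Lemma crossDr u v w : cross u (v + w) = cross u v + cross u w.
Proof. by rewrite /cross /=; ring. Qed.

Lemma crossDl u v w : cross (v + w) u = cross v u + cross w u.
Proof. by rewrite /cross /=; ring. Qed.

Lemma crossC u v : cross u v = - cross v u.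
Proof. by rewrite /cross; ring. Qed.

Lemma crossvv u : cross u u = 0.
Proof. by rewrite /cross; ring. Qed.

Lemma cross_basis u v z : cross u v = 1 ->
  z.1 = cross z v * u.1 + cross u z * v.1 /\
  z.2 = cross z v * u.2 + cross u z * v.2.
Proof.
move=> e; split.
  by rewrite -[LHS]mulr1 -e /cross; ring.
by rewrite -[LHS]mulr1 -e /cross; ring.
Qed.

(** A maximal cone, given by its two bounding rays in counterclockwise order. *)
Definition sector : Type := (ivec * ivec)%type.

Definition quadrant (q : bool * bool) : sector :=
  match q with
  | (true, true) => ((1, 0), (0, 1))
  | (true, false) => ((0, 1), (-1, 0))
  | (false, true) => ((-1, 0), (0, -1))
  | (false, false) => ((0, -1), (1, 0))
  end.

(** The two halves of a blow-up of a smooth cone: the new ray is the sum of the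
    two old ones, so both halves are smooth again. *)
Definition child (b : bool) (c : sector) : sector :=
  if b then (c.1, c.1 + c.2) else (c.1 + c.2, c.2).

(** The words of length n index the maximal cones of the n-th fan; prefixes of
    a word index the coarser cones that contain its cone. *)
Definition cone (q : bool * bool) (w : seq bool) : sector :=
  foldl (fun c b => child b c) (quadrant q) w.

Lemma cone_rcons q w b : cone q (rcons w b) = child b (cone q w).
Proof. by rewrite /cone foldl_rcons. Qed.

Lemma cross_cone q w : cross (cone q w).1 (cone q w).2 = 1.
Proof.
elim/last_ind: w => [|w b IH]; first by case: q => [[] []].
rewrite cone_rcons /child; case: b => /=;
  by rewrite ?crossDr ?crossDl crossvv ?add0r ?addr0.
Qed.

Lemma inner_gt0 u v : cross u v != 0 -> 0 < inner u u.
Proof.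
case: u v => [a b] [c d]; rewrite /cross /inner /= => h.
have [a0|a0] := eqVneq a 0; last by nia.
by have [b0|b0] := eqVneq b 0; [move: h; rewrite a0 b0; nia|nia].
Qed.

(** Cones get thin: with [cross u v = 1], the cotangent of the angle between u
    and v is [inner u v], and each subdivision adds at least 1 to it because it
    replaces one ray by the sum. *)
Lemma inner_cone q w : (size w)%:Z <= inner (cone q w).1 (cone q w).2.
Proof.
elim/last_ind: w => [|w b IH]; first by case: q => [[] []].
have c1 := cross_cone q w.
have := @inner_gt0 (cone q w).1 (cone q w).2; rewrite c1 => /(_ isT) u0.
have := @inner_gt0 (cone q w).2 (cone q w).1; rewrite crossC c1 => /(_ isT) v0.
rewrite cone_rcons size_rcons /child; case: b => /=;
  move: u0 v0 IH; rewrite /inner /=; lia.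
Qed.

Lemma cone_prev q w : exists q' w',
  size w' = size w /\ (cone q' w').2 = (cone q w).1.
Proof.
elim/last_ind: w => [|w b [q' [w' [sw e]]]].
  by case: q => [[] []]; [exists (false, false)|exists (true, true)|
    exists (true, false)|exists (false, true)]; exists [::].
case: b; last first.
  by exists q, (rcons w true); rewrite !size_rcons !cone_rcons.
exists q', (rcons w' false); rewrite !size_rcons sw !cone_rcons; split=> //.
Qed.

Lemma cone_next q w : exists q' w',
  size w' = size w /\ (cone q' w').1 = (cone q w).2.
Proof.
elim/last_ind: w => [|w b [q' [w' [sw e]]]].
  by case: q => [[] []]; [exists (true, false)|exists (false, true)|
    exists (false, false)|exists (true, true)]; exists [::].
case: b.
  by exists q, (rcons w false); rewrite !size_rcons !cone_rcons.
exists q', (rcons w' true); rewrite !size_rcons sw !cone_rcons; split=> //.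
Qed.

Definition in_sector (z : ivec) (c : sector) : bool :=
  (0 <= cross c.1 z) && (0 <= cross z c.2).

(** An interior point of a child is an interior point of its parent, so by
    induction the parents agree; two different children of one parent are
    separated by the ray [u + v]. *)
Lemma cone_interiors_disjoint q w q' w' z : size w = size w' ->
  in_sector z (cone q w) ->
  0 < cross (cone q' w').1 z -> 0 < cross z (cone q' w').2 ->
  cone q w = cone q' w'.
Proof.
elim/last_ind: w w' => [|w b IH] w'.
  move=> /esym/size0nil -> /andP[]; case: z => x y.
  by case: q => [[] []]; case: q' => [[] []] //; rewrite /cross /=; lia.
case/lastP: w' => [|w' b']; first by rewrite size_rcons.
rewrite !size_rcons => -[sw]; rewrite /in_sector !cone_rcons.
have := IH w' sw; rewrite /in_sector; move: (cone q w) (cone q' w').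
move=> [u v] [u' v'] /= {}IH; have z0 := crossvv z.
case: b; case: b' => /=; rewrite ?crossDr ?crossDl => /andP[h1 h2] h3 h4;
  have := crossC u z; have := crossC z v; have := crossC u' z;
  have := crossC z v' => e1 e2 e3 e4.
all: have [e e'] : (u, v) = (u', v') by apply: IH; lia.
1,4: by rewrite e e'.
1,2: by move: h1 h2 h3 h4; rewrite e e'; lia.
Qed.

Lemma mulz_eq1_ge0 (a k : int) : 0 <= a -> a * k = 1 -> a = 1.
Proof.
move=> a0 e; have k0 : 0 < k by rewrite ltNge; apply/negP => k0; nia.
by have [a1|a1] := leP a 1; nia.
Qed.

(** Makes the subdivision a fan: a ray of the level meets a cone of the level
    only as one of its two sides.  A ray in the interior would make two cones
    with a common interior point. *)
Lemma ray_in_cone q w q' w' z : size w = size w' ->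
  z = (cone q' w').1 \/ z = (cone q' w').2 -> in_sector z (cone q w) ->
  z = (cone q w).1 \/ z = (cone q w).2.
Proof.
move=> sw zr /andP[].
have d := cross_cone q w.
(* a member of a unimodular pair is no proper multiple of an integer vector *)
have multiple a u : z.1 = a * u.1 -> z.2 = a * u.2 -> 0 <= a -> z = u.
  move=> e1 e2 a0; suff a1 : a = 1.
    by rewrite [z]surjective_pairing e1 e2 a1 !mul1r -surjective_pairing.
  have := cross_cone q' w'; case: zr => <-; rewrite /cross e1 e2 => e.
  - by apply: (@mulz_eq1_ge0 _ (cross u (cone q' w').2)); rewrite // -e /cross; ring.
  - by apply: (@mulz_eq1_ge0 _ (cross (cone q' w').1 u)); rewrite // -e /cross; ring.
have [e1 e2] := cross_basis z d.
rewrite le_eqVlt => /orP[/eqP/esym z1|z1].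
  by move=> z2; left; apply: multiple z2; rewrite ?e1 ?e2 z1 mul0r addr0.
rewrite le_eqVlt => /orP[/eqP/esym z2|z2].
  by right; apply: multiple (ltW z1); rewrite ?e1 ?e2 z2 mul0r add0r.
rewrite -(@cone_interiors_disjoint q' w' q w z (esym sw)) // /in_sector.
by case: zr => ->; rewrite crossvv lexx (cross_cone q' w').
Qed.
(** * Integer covectors acting on the real plane *)

Section PlaneVectors.
Variable R : realType.
Local Notation plane := 'rV[R]_2.
Implicit Types (x y : plane) (u v z : ivec).

Definition point (a b : R) : plane := \row_(i < 2) (if i == 0 then a else b).

Definition rvec z : plane := point z.1%:~R z.2%:~R.

Definition perp z : ivec := (- z.2, z.1).

Lemma rvec_perp z : rvec (perp z) = point (- z.2%:~R) z.1%:~R.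
Proof. by congr point; exact: intrN. Qed.

(** Integer vectors act as linear forms: they are the outer normals of edges. *)
Definition pairing z x : R := z.1%:~R * x ord0 0 + z.2%:~R * x ord0 1.

Lemma planeP x y : x ord0 0 = y ord0 0 -> x ord0 1 = y ord0 1 -> x = y.
Proof.
move=> e0 e1; apply/rowP => -[[|[|//]] lt2].
- by rewrite (_ : Ordinal lt2 = 0) //; exact: val_inj.
- by rewrite (_ : Ordinal lt2 = 1) //; exact: val_inj.
Qed.

Lemma pairingD z x y : pairing z (x + y) = pairing z x + pairing z y.
Proof. by rewrite /pairing !mxE; ring. Qed.

Lemma pairingN z x : pairing z (- x) = - pairing z x.
Proof. by rewrite /pairing !mxE; ring. Qed.

Lemma pairingZ z a x : pairing z (a *: x) = a * pairing z x.
Proof. by rewrite /pairing !mxE; ring. Qed.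

Definition pairing_lin := (pairingN, pairingD, pairingZ).

Lemma intr_cross u v :
  (cross u v)%:~R = u.1%:~R * v.2%:~R - u.2%:~R * v.1%:~R :> R.
Proof. by rewrite /cross rmorphB !rmorphM. Qed.

Lemma pairing_perp u z : pairing z (rvec (perp u)) = (cross u z)%:~R.
Proof. by rewrite intr_cross /pairing rvec_perp !mxE /=; ring. Qed.

(** Cramer's rule for the basis dual to [(u, v)]; the quarter turns [perp u] and
    [perp v] direct the edges with normals u and v. *)
Lemma plane_coord u v x : cross u v = 1 ->
  x = pairing v x *: rvec (perp u) - pairing u x *: rvec (perp v).
Proof.
move=> /(congr1 (fun k : int => k%:~R : R)); rewrite intr_cross => e.
apply: planeP; rewrite /pairing !rvec_perp !mxE /=;
  rewrite -[LHS]mul1r -[1 * _]/(1%:~R * _) -e; ring.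
Qed.

Lemma on_line u v x y : cross u v = 1 -> pairing u y = pairing u x ->
  y = x - (pairing v x - pairing v y) *: rvec (perp u).
Proof.
move=> cuv e; rewrite [LHS](plane_coord _ cuv) e.
rewrite [X in _ = X - _](plane_coord _ cuv).
by apply: planeP; rewrite !mxE; ring.
Qed.

Lemma rvec_eq0 z : (rvec z == 0) = (z == 0).
Proof.
apply/eqP/eqP => [e|->]; last by apply: planeP; rewrite !mxE.
have := congr1 (fun x : plane => x ord0 0) e.
have := congr1 (fun x : plane => x ord0 1) e.
rewrite !mxE /= => /eqP; rewrite intr_eq0 => /eqP e2 /eqP.
by rewrite intr_eq0 => /eqP e1; rewrite [z]surjective_pairing e1 e2.
Qed.

Lemma rvec_perp_neq0 u v : cross u v = 1 -> rvec (perp u) != 0.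
Proof.
case: u v => [a b] [c d]; rewrite rvec_eq0 /perp /cross /= => e.
by apply/eqP => -[b0 a0]; move: e; rewrite a0 mul0r; lia.
Qed.

Lemma dotE x y : dot x y = x ord0 0 * y ord0 0 + x ord0 1 * y ord0 1.
Proof.
rewrite /dot big_ord_recl big_ord1.
by congr (_ + _ * _); congr (_ _ _); exact: val_inj.
Qed.

Lemma dot_cone a b u v x :
  dot (a *: rvec u + b *: rvec v) x = a * pairing u x + b * pairing v x.
Proof. by rewrite dotE /pairing !mxE /=; ring. Qed.

Lemma dot_gt0 x : x != 0 -> 0 < dot x x.
Proof.
apply: contraNT; rewrite dotE -leNgt => h.
have := sqr_ge0 (x ord0 0); have := sqr_ge0 (x ord0 1) => h1 h0.
by apply/eqP/planeP; rewrite mxE; apply/eqP; rewrite -sqrf_eq0; apply/eqP; nra.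
Qed.

Lemma has_dim_inj d d' (A : set plane) : has_dim d A -> has_dim d' A -> d = d'.
Proof.
move=> [_ [U [<- UA Umin]]] [_ [U' [<- UA' Umin']]].
by congr (\dim _); apply: subv_anti; rewrite Umin // Umin'.
Qed.

Lemma has_dim_set1 x : has_dim 0 [set x].
Proof.
split; first by exists x.
exists 0%VS; split; first exact: dimv0.
- by move=> ? ? -> ->; rewrite subrr mem0v.
- by move=> W _; exact: sub0v.
Qed.

Definition int_row z : 'rV[int]_2 := \row_(i < 2) (if i == 0 then z.1 else z.2).

Definition of_int_row (w : 'rV[int]_2) : ivec := (w ord0 0, w ord0 1).

Lemma of_int_rowK w : int_row (of_int_row w) = w.
Proof.
apply/rowP => -[[|[|//]] lt2]; rewrite !mxE /=; congr (w _ _); exact: val_inj.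
Qed.

Lemma map_int_row z : map_mx intr (int_row z) = rvec z.
Proof. by apply: planeP; rewrite !mxE. Qed.

Lemma map_int_row_rat z : map_mx ratr (map_mx intr (int_row z)) = rvec z.
Proof. by apply: planeP; rewrite !mxE ratr_int. Qed.

(** The orientation -1 is the one met at a vertex, where the edge vectors are
    [- perp u] and [perp v]. *)
Lemma Z2_basis_int_row u v : cross u v = -1 -> Z2_basis (int_row u) (int_row v).
Proof.
move=> d w; rewrite -[w]of_int_rowK; move: (of_int_row w) => {w} [x y].
have c1 : cross v u = 1 by rewrite crossC d opprK.
exists (cross v (x, y), cross (x, y) u); split.
  have [/= e1 e2] := cross_basis (x, y) c1.
  apply/rowP => -[[|[|//]] lt2]; rewrite !mxE /= [LHS](e1, e2) addrC //.
move=> [a b] /= e; have := congr1 of_int_row e.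
rewrite /of_int_row !mxE /= => -[-> ->].
by congr (_, _); rewrite -[RHS]mulr1 -c1 /cross /=; ring.
Qed.

Lemma primitive_int_row u v : cross u v = 1 \/ cross u v = -1 ->
  primitive (int_row u).
Proof.
rewrite /primitive !mxE /= => d; apply/coprimezP.
case: d => d; [exists (v.2, - v.1)|exists (- v.2, v.1)]; move: d;
  rewrite /cross /= => d; lia.
Qed.

(** A primitive vector on the ray of e is e itself: it is a nonnegative integer
    multiple k of e, and k divides a coprime pair. *)
Lemma primitive_direction z e f (s t : R) : primitive (int_row z) ->
  cross e f = 1 -> 0 < t -> 0 <= s -> t *: rvec z = s *: rvec e -> z = e.
Proof.
rewrite /primitive !mxE /= => /coprimezP[[a b] /= ab] d t0 s0 h.
have h1 := congr1 (fun x : plane => x ord0 0) h.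
have h2 := congr1 (fun x : plane => x ord0 1) h.
move: h1 h2; rewrite !mxE /= => h1 h2.
have ez : cross e z = 0.
  apply/eqP; rewrite -(@intr_eq0 R) -(mulrI_eq0 _ (lregP (negbT (gt_eqF t0)))).
  by rewrite intr_cross; apply/eqP; transitivity (s * (e.1%:~R * e.2%:~R - e.2%:~R * e.1%:~R));
    [rewrite mulrBr mulrCA h2 [X in _ - X]mulrCA h1|]; ring.
have [] := cross_basis z d; rewrite ez !mul0r !addr0 => e1 e2.
set k := cross z f in e1 e2.
suff k1 : k = 1.
  by rewrite [z]surjective_pairing e1 e2 k1 !mul1r -surjective_pairing.
apply: (@mulz_eq1_ge0 _ (a * e.1 + b * e.2)); last by rewrite -ab e1 e2; ring.
rewrite -(@ler0z R) -(pmulr_rge0 _ t0).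
suff -> : t * k%:~R = s by [].
transitivity (t * (cross z f)%:~R) => //.
rewrite intr_cross mulrBr !mulrA h1 h2 -!mulrA -mulrBr -intr_cross d mulr1.
by [].
Qed.

End PlaneVectors.
(** * A criterion for being a Delzant polygon *)

Section SmoothFamily.
Variables (R : realType) (I : finType) (sec : I -> sector) (p : I -> 'rV[R]_2).
Local Notation plane := 'rV[R]_2.
Implicit Types (i j k : I) (x y : plane) (z : ivec).

Definition is_ray i z := z = (sec i).1 \/ z = (sec i).2.

(** A polygon presented by its vertices [p i], one for each maximal cone [sec i]
    of a complete smooth fan.  The last two fields say that a ray of [sec j]
    is maximized at [p j], and at [p i] as well only if it is a ray of
    [sec i]: the fan is the normal fan and no edge is degenerate.  Both are
    compatible with convex combinations of families, which is what makes
    Minkowski segments easy to treat. *)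
Record smooth_family : Prop := SmoothFamily {
  family_unimodular : forall i, cross (sec i).1 (sec i).2 = 1;
  family_complete : forall x, exists i a b,
    [/\ 0 <= a, 0 <= b & x = a *: rvec R (sec i).1 + b *: rvec R (sec i).2];
  family_prev : forall i, exists j, (sec j).2 = (sec i).1;
  family_next : forall i, exists j, (sec j).1 = (sec i).2;
  family_le : forall i j z, is_ray j z -> pairing z (p i) <= pairing z (p j);
  family_eq : forall i j z, is_ray j z -> pairing z (p i) = pairing z (p j) ->
    is_ray i z
}.

Hypothesis fam : smooth_family.

Let uni := family_unimodular fam.
Let nxt := family_next fam.
Let prv := family_prev fam.

(** The same polygon in the dual description. *)
Definition halfplanes : set plane :=
  [set x | forall i, pairing (sec i).1 x <= pairing (sec i).1 (p i)].

Definition side i : set plane :=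
  [set x | halfplanes x /\ pairing (sec i).1 x = pairing (sec i).1 (p i)].

Let ray1 i : is_ray i (sec i).1. Proof. by left. Qed.
Let ray2 i : is_ray i (sec i).2. Proof. by right. Qed.
#[local] Hint Resolve ray1 ray2 : core.

Lemma family_ray_eq i j z : is_ray i z -> is_ray j z ->
  pairing z (p i) = pairing z (p j).
Proof. by move=> iz jz; apply/le_anti; rewrite !(family_le fam). Qed.

Lemma halfplanes_ray x i z : halfplanes x -> is_ray i z ->
  pairing z x <= pairing z (p i).
Proof.
move=> Qx [->|->]; first exact: Qx.
by have [j e] := nxt i; rewrite (@family_ray_eq i j) -?e //; right.
Qed.

Lemma halfplanes_vertex i : halfplanes (p i).
Proof. by move=> j; exact: (family_le fam). Qed.

Lemma halfplanes_convex : @convex_set R plane halfplanes.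
Proof.
apply/convex_setP => x y t Qx Qy t0 t1 i.
rewrite !pairing_lin; have := Qx i; have := Qy i; nra.
Qed.

(** The edge with normal [u = (sec i).1] runs from [p j] to [p i] for j the
    preceding cone.  Its length is positive: otherwise the second ray of [sec i]
    would be maximized at [p j], hence be a ray of [sec j]. *)
Lemma prev_vertex i j : (sec j).2 = (sec i).1 ->
  exists2 l, 0 < l & p j = p i - l *: rvec R (perp (sec i).1).
Proof.
move=> e; set u := (sec i).1; set v := (sec i).2.
have cuv : cross u v = 1 by exact: uni.
have eu : pairing u (p j) = pairing u (p i).
  by apply: family_ray_eq => //; right.
exists (pairing v (p i) - pairing v (p j)).
  rewrite subr_gt0 lt_neqAle (family_le fam) ?andbT; last exact: ray2.
  apply/eqP => /(family_eq fam (ray2 i)) [ev|ev]; last first.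
    by move: cuv; rewrite /v ev e crossvv.
  by have := uni j; rewrite e -ev crossC -/u -/v cuv.
exact: (on_line cuv eu).
Qed.

(** The two bounding inequalities of the side come from the neighbouring
    normals [(sec i).2] and [(sec j).1]. *)
Lemma sideP i j l x : 0 < l -> (sec j).2 = (sec i).1 ->
    p j = p i - l *: rvec R (perp (sec i).1) ->
  side i x <-> exists2 s, 0 <= s <= l & x = p i - s *: rvec R (perp (sec i).1).
Proof.
move=> l0 e pj; set u := (sec i).1; set v := (sec i).2.
have cuv : cross u v = 1 by exact: uni.
split=> [[Qx xu]|[s /andP[s0 sl] ->]]; last first.
  have -> : p i - s *: rvec R (perp u) = (1 - s / l) *: p i + (s / l) *: p j.
    have ln : l != 0 by rewrite gt_eqF.
    by rewrite pj; apply: planeP; rewrite !mxE; field.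
  split; last first.
    have eu : pairing u (p j) = pairing u (p i).
      by apply: family_ray_eq => //; right.
    by rewrite !pairing_lin -/u eu; ring.
  have := (@convex_setP R halfplanes).1 halfplanes_convex (p i) (p j) (1 - s / l).
  rewrite (_ : 1 - (1 - s / l) = s / l); last by ring.
  by apply; rewrite ?subr_ge0 ?lerBlDr ?lerDl ?divr_ge0 ?ler_pdivrMr ?mul1r //;
    try exact: halfplanes_vertex; exact: ltW.
have ex : x = p i - (pairing v (p i) - pairing v x) *: rvec R (perp u).
  exact: (on_line cuv xu).
have s0 : 0 <= pairing v (p i) - pairing v x.
  by rewrite subr_ge0 (halfplanes_ray Qx (ray2 i)).
have := halfplanes_ray Qx (ray1 j).
move: ex s0; set s := pairing v (p i) - pairing v x => ex s0.
have := uni j; rewrite e -/u => cwu.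
rewrite ex pj !pairing_lin pairing_perp -/u crossC cwu => h.
by exists s => //; move: h; rewrite s0 /=; lra.
Qed.

Lemma side_has_dim i : has_dim 1 (side i).
Proof.
have [j e] := prv i; have [l l0 pj] := prev_vertex e.
have P x := sideP x l0 e pj; set d := rvec R (perp (sec i).1) in P pj *.
have Si : side i (p i) by split=> //; exact: halfplanes_vertex.
have Sj : side i (p j).
  by apply/P; exists l; rewrite // lexx ltW.
split; first by exists (p i).
exists <[d]>%VS; split.
- by rewrite dim_vline (rvec_perp_neq0 _ (uni i)).
- move=> x y /P[s _ ->] /P[t _ ->]; apply/vlineP; exists (t - s).
  by apply: planeP; rewrite !mxE; ring.
- move=> W HW; have := HW _ _ Si Sj; rewrite pj opprB addrC subrK => dW.
  by rewrite -memvE -[d](scalerK (negbT (gt_eqF l0))) memvZ.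
Qed.

Lemma halfplanes_has_dim : I -> has_dim 2 halfplanes.
Proof.
move=> i; have [j e] := prv i; have [l l0 pj] := prev_vertex e.
have [k e'] := nxt i; have [m m0 pk] := prev_vertex (esym e').
split; first by exists (p i); exact: halfplanes_vertex.
exists fullv; split; first by rewrite dimvf.
- by move=> x y _ _; exact: memvf.
move=> W HW; apply/subvP => x _.
have Qp := halfplanes_vertex; rewrite (plane_coord x (uni i)).
have uW : rvec R (perp (sec i).1) \in W.
  have := HW _ _ (Qp i) (Qp j); rewrite pj opprB addrC subrK => lW.
  by rewrite -[rvec _ _](scalerK (negbT (gt_eqF l0))) memvZ.
have vW : rvec R (perp (sec i).2) \in W.
  have := HW _ _ (Qp k) (Qp i); rewrite pk opprB addrC subrK e' => mW.
  by rewrite -[rvec _ _](scalerK (negbT (gt_eqF m0))) memvZ.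
by rewrite memvB ?memvZ.
Qed.

Lemma ray_towards x : x != 0 -> exists i, 0 < pairing (sec i).1 x.
Proof.
move=> /dot_gt0; have [k [a [b [a0 b0 {1}->]]]] := family_complete fam x.
rewrite dot_cone => h.
have [u0|u0] := ltP 0 (pairing (sec k).1 x); first by exists k.
have [v0|v0] := ltP 0 (pairing (sec k).2 x); last by nra.
by have [j e] := nxt k; exists j; rewrite e.
Qed.

(** The half-line from x leaves the polygon through the constraint of least
    exit time. *)
Lemma exits_halfplanes x d : halfplanes x -> d != 0 ->
  exists2 s, 0 <= s & exists i, side i (x + s *: d).
Proof.
move=> Qx /ray_towards[i0 di0].
case: (@arg_minP _ _ _ i0 (fun i => 0 < pairing (sec i).1 d)
  (fun i => (pairing (sec i).1 (p i) - pairing (sec i).1 x) / pairing (sec i).1 d)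
  di0) => i di imin.
set s := (_ / _) in imin.
have s0 : 0 <= s by apply: divr_ge0; [rewrite subr_ge0; exact: Qx|exact: ltW].
exists s => //; exists i; split; last first.
  by rewrite !pairing_lin /s divfK ?gt_eqF // addrC subrK.
move=> j; rewrite !pairing_lin.
have [dj|dj] := ltP 0 (pairing (sec j).1 d); last by have := Qx j; nra.
by have := imin j dj; rewrite ler_pdivlMr //; lra.
Qed.

Lemma side_sub_hull i : side i `<=` convex_hull (range p).
Proof.
have [j e] := prv i; have [l l0 pj] := prev_vertex e.
move=> x /(sideP x l0 e pj)[s /andP[s0 sl] ->].
have -> : p i - s *: rvec R (perp (sec i).1) = (1 - s / l) *: p i + (s / l) *: p j.
  have ln : l != 0 by rewrite gt_eqF.
  by rewrite pj; apply: planeP; rewrite !mxE; field.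
have pH k : convex_hull (range p) (p k) by apply: sub_gen_smallest; exists k.
have := (@convex_setP R _).1 (@convex_hull_convex R (range p)) (p i) (p j) (1 - s / l).
rewrite (_ : 1 - (1 - s / l) = s / l); last by ring.
by apply; rewrite ?subr_ge0 ?lerBlDr ?lerDl ?divr_ge0 ?ler_pdivrMr ?mul1r //; exact: ltW.
Qed.

(** Each point lies on a chord whose ends are on sides, and the sides are
    segments between the points [p i]. *)
Lemma halfplanes_hull : I -> halfplanes = convex_hull (range p).
Proof.
move=> i0; apply/seteqP; split=> [x Qx|]; last first.
  apply: smallest_sub; first exact: halfplanes_convex.
  by move=> _ [i _ <-]; exact: halfplanes_vertex.
have d0 := rvec_perp_neq0 R (uni i0); set d := rvec _ _ in d0.
have [s s0 [i si]] := exits_halfplanes Qx d0.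
have [|t t0 [j tj]] := exits_halfplanes (d := - d) Qx; first by rewrite oppr_eq0.
have {}si := side_sub_hull si; have {}tj := side_sub_hull tj.
have [st0|st0] := eqVneq (s + t) 0.
  have s00 : s = 0 by lra.
  by move: si; rewrite s00 scale0r addr0.
have st : 0 < s + t by rewrite lt_neqAle eq_sym st0 addr_ge0.
have -> : x = (t / (s + t)) *: (x + s *: d) + (1 - t / (s + t)) *: (x + t *: - d).
  by apply: planeP; rewrite !mxE; field.
apply: (@convex_setP R _).1 => //; first exact: convex_hull_convex.
  by rewrite divr_ge0 // ltW.
by rewrite ler_pdivrMr // mul1r lerDr.
Qed.

Lemma at_vertex i x : halfplanes x ->
  pairing (sec i).1 x = pairing (sec i).1 (p i) ->
  pairing (sec i).2 x = pairing (sec i).2 (p i) -> x = p i.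
Proof.
by move=> Qx e1 e2; rewrite (on_line (uni i) e1) e2 subrr scale0r subr0.
Qed.

Definition support_set a b i : set plane := [set x | halfplanes x /\
  forall y, halfplanes y ->
    dot (a *: rvec R (sec i).1 + b *: rvec R (sec i).2) y <=
    dot (a *: rvec R (sec i).1 + b *: rvec R (sec i).2) x].

(** A linear form in the cone of [sec i] is a nonnegative combination of two
    forms that are maximal at [p i], so it is maximized where those with
    nonzero weight are. *)
Lemma support_setE a b i : 0 <= a -> 0 <= b ->
  support_set a b i = [set x | [/\ halfplanes x,
    a != 0 -> pairing (sec i).1 x = pairing (sec i).1 (p i) &
    b != 0 -> pairing (sec i).2 x = pairing (sec i).2 (p i)]].
Proof.
move=> a0 b0; apply/seteqP; split=> x [Qx] /=.
  move=> /(_ _ (halfplanes_vertex i)); rewrite !dot_cone => h.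
  have h1 := halfplanes_ray Qx (ray1 i); have h2 := halfplanes_ray Qx (ray2 i).
  have h3 := ler_wpM2l a0 h1; have h4 := ler_wpM2l b0 h2.
  split=> // c0; apply/eqP; rewrite eq_le ?h1 ?h2 /=.
    by rewrite -(@ler_pM2l _ a) ?lt_neqAle ?(eq_sym 0) ?c0 //; lra.
  by rewrite -(@ler_pM2l _ b) ?lt_neqAle ?(eq_sym 0) ?c0 //; lra.
move=> e1 e2; split=> // y Qy; rewrite !dot_cone.
have h1 := halfplanes_ray Qy (ray1 i); have h2 := halfplanes_ray Qy (ray2 i).
apply: lerD.
  by have [->|/e1 ->] := eqVneq a 0; rewrite ?mul0r // ler_wpM2l.
by have [->|/e2 ->] := eqVneq b 0; rewrite ?mul0r // ler_wpM2l.
Qed.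

Lemma face_cases F : face halfplanes F ->
  [\/ F = halfplanes, exists i, F = [set p i] | exists i, F = side i].
Proof.
move=> [c]; have [i [a [b [a0 b0 ->]]]] := family_complete fam c.
rewrite -/(support_set a b i) support_setE // => ->.
have [a00|an] := eqVneq a 0; have [b00|bn] := eqVneq b 0.
- by apply: Or31; apply/seteqP; split=> x //= [].
- apply: Or33; have [j e] := nxt i; exists j.
  have ej : pairing (sec j).1 (p j) = pairing (sec i).2 (p i).
    by rewrite e (@family_ray_eq j i) // -e.
  apply/seteqP; split=> x /=; rewrite /side ej e.
    by move=> [Qx _ /(_ isT)].
  by move=> [].
- apply: Or33; exists i; apply/seteqP; split=> x /=.
    by move=> [Qx /(_ isT)].
  by move=> [].
- apply: Or32; exists i; apply/seteqP; split=> x /=.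
    by move=> [Qx e1 e2]; apply: at_vertex; rewrite ?e1 ?e2.
  by move=> ->; split=> //; exact: halfplanes_vertex.
Qed.

Lemma edge_side i : edge halfplanes (side i).
Proof.
split; last exact: side_has_dim.
exists (1 *: rvec R (sec i).1 + 0 *: rvec R (sec i).2).
rewrite -/(support_set 1 0 i) support_setE //; apply/seteqP; split=> x /=.
  by move=> [Qx e]; split; rewrite ?eqxx.
by move=> [Qx /(_ (oner_neq0 _))].
Qed.

Lemma edge_is_side F : edge halfplanes F -> exists i, F = side i.
Proof.
move=> [/face_cases[-> F1|[i ->] F1|//]].
  have [i _] := family_complete fam 0.
  by have := has_dim_inj F1 (halfplanes_has_dim i).
by have := has_dim_inj F1 (has_dim_set1 (p i)).
Qed.

Lemma vertex_is_p x : vertex halfplanes x -> exists i, x = p i.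
Proof.
move=> /face_cases[e|[i e]|[i e]].
- have [i _] := family_complete fam 0.
  by have := halfplanes_has_dim i; rewrite -e => /(has_dim_inj (has_dim_set1 x)).
- by exists i; have : [set x] x by []; rewrite e.
- by have := side_has_dim i; rewrite -e => /(has_dim_inj (has_dim_set1 x)).
Qed.

Lemma side_of_ray i j : (sec j).1 = (sec i).1 -> side j = side i.
Proof.
move=> e; rewrite /side e (@family_ray_eq j i) //.
by left.
Qed.

(** At [p i] one leaves backwards along the side of the first ray and forwards
    along the side of the second, hence the sign. *)
Lemma edge_vectors i : primitive_edge_vector halfplanes (p i) =
  [set int_row (- perp (sec i).1); int_row (perp (sec i).2)].
Proof.
have [j ej] := prv i; have [l l0 pj] := prev_vertex ej.
have [k ek] := nxt i; have [m m0 pi] := prev_vertex (esym ek).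
have Si : side i (p i) by split=> //; exact: halfplanes_vertex.
have Sj : side i (p j) by apply/(sideP _ l0 ej pj); exists l; rewrite // lexx ltW.
have Sk : side k (p k) by split=> //; exact: halfplanes_vertex.
have Ski : side k (p i).
  by apply/(sideP _ m0 (esym ek) pi); exists m; rewrite // lexx ltW.
set u := (sec i).1; set v := (sec i).2.
have cuv : cross u v = 1 by exact: uni.
have rN : rvec R (- perp u) = - rvec R (perp u).
  by apply: planeP; rewrite !mxE /=; exact: intrN.
apply/seteqP; split=> [w [wp [E [/edge_is_side[n ->] np [t t0]]]]|w [->|->]].
- rewrite -[w]of_int_rowK in wp *; move: (of_int_row w) wp => {w} z zp.
  rewrite map_int_row => nt.
  have [_ /(family_eq fam (ray1 n))[enu|env]] := np.
    move: nt; rewrite (side_of_ray enu) => /(sideP _ l0 ej pj)[s /andP[s0 _]].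
    move=> /addrI e; left; congr int_row.
    apply: (@primitive_direction R z (- perp u) (- perp v) s t) => //.
      by move: cuv; rewrite /cross /perp /=; lia.
    by rewrite e rN scalerN.
  move: nt; rewrite (side_of_ray (etrans env (esym ek))).
  move=> /(sideP _ m0 (esym ek) pi)[s /andP[_ sm]]; rewrite ek -/v pi ek -/v => e.
  right; congr int_row.
  apply: (@primitive_direction R z (perp v) (- perp u) (m - s) t) => //.
  - by move: cuv; rewrite /cross /perp /=; lia.
  - by rewrite subr_ge0.
  - move: e; rewrite -addrA => /addrI e.
    by rewrite scalerBl -e addNKr.
- split; first by apply: (@primitive_int_row _ (- perp v)); move: cuv;
    rewrite /cross /perp /=; lia.
  exists (side i); split=> //; first exact: edge_side.
  by exists l => //; rewrite map_int_row rN scalerN -pj.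
- split; first by apply: (@primitive_int_row _ (- perp u)); move: cuv;
    rewrite /cross /perp /=; lia.
  exists (side k); split=> //; first exact: edge_side.
  by exists m => //; rewrite map_int_row pi ek -/v subrK.
Qed.

Lemma smooth_family_delzant : is_delzant (convex_hull (range p)).
Proof.
have [i0 _] := family_complete fam 0.
rewrite -(halfplanes_hull i0); split.
- exists (range p); last exact: halfplanes_hull.
  exact: finite_image.
- exact: halfplanes_has_dim.
- move=> E /edge_is_side[i ->]; have [j ej] := prv i.
  have [l l0 pj] := prev_vertex ej.
  exists (map_mx intr (int_row (perp (sec i).1))).
    apply/negP => /eqP /(congr1 (map_mx (ratr : rat -> R))).
    rewrite map_int_row_rat map_mx0 => /eqP.
    by rewrite (negbTE (rvec_perp_neq0 R (uni i))).
  move=> x y /(sideP _ l0 ej pj)[s _ ->] /(sideP _ l0 ej pj)[t _ ->].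
  exists (t - s); rewrite map_int_row_rat.
  by apply: planeP; rewrite !mxE; ring.
- move=> x /vertex_is_p[i ->].
  exists (int_row (- perp (sec i).1)), (int_row (perp (sec i).2)).
  split; last exact: edge_vectors.
  by apply: Z2_basis_int_row; have := uni i; rewrite /cross /perp /=; lia.
Qed.

End SmoothFamily.
(** * The Euclidean norm on integer covectors *)

Section Norm.
Variable R : realType.
Implicit Types (u v z : ivec).

Definition nrm z : R := Num.sqrt (inner z z)%:~R.

Lemma inner_ge0 z : 0 <= inner z z.
Proof. by rewrite /inner; nia. Qed.

Lemma nrm_ge0 z : 0 <= nrm z.
Proof. exact: sqrtr_ge0. Qed.

Lemma nrm_sq z : nrm z ^+ 2 = (inner z z)%:~R.
Proof. by rewrite sqr_sqrtr // ler0z inner_ge0. Qed.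

Lemma lagrange u v : inner u u * inner v v = inner u v ^+ 2 + cross u v ^+ 2.
Proof. by rewrite /inner /cross; ring. Qed.

Lemma nrm_mul_sq u v : cross u v = 1 ->
  (nrm u * nrm v) ^+ 2 = (inner u v)%:~R ^+ 2 + 1.
Proof.
by move=> d; rewrite exprMn !nrm_sq -intrM lagrange d !expr2 !(intrD, intrM) mulr1.
Qed.

Lemma nrm_mul_gt u v : cross u v = 1 -> 0 <= inner u v ->
  (inner u v)%:~R < nrm u * nrm v.
Proof.
move=> d i0; rewrite -(@ltr_pXn2r _ 2%N) ?nnegrE ?ler0z ?mulr_ge0 ?nrm_ge0 //.
by rewrite (nrm_mul_sq d) ltrDl.
Qed.

Lemma nrm_gt0 u v : cross u v != 0 -> 0 < nrm u.
Proof. by move=> /inner_gt0 h; rewrite sqrtr_gt0 ltr0z. Qed.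

Lemma nrm_cross_basis u v z : cross u v = 1 ->
  nrm z ^+ 2 = (cross z v)%:~R ^+ 2 * nrm u ^+ 2 + (cross u z)%:~R ^+ 2 * nrm v ^+ 2
    + 2 * ((cross z v)%:~R * (cross u z)%:~R * (inner u v)%:~R).
Proof.
move=> /(cross_basis z)[e1 e2]; rewrite !nrm_sq [in LHS]/inner e1 e2 /inner.
by rewrite !(intrD, intrM); ring.
Qed.

(** Strict convexity of the norm in the form used at a vertex.  Let [z = x u + y v].
    If [x y < 0], Cauchy-Schwarz gives [|z|^2 > (x |u| + y |v|)^2], strictly since
    u and v are not parallel; otherwise neither x nor y is positive and the
    left-hand side is negative. *)
Lemma nrm_strict u v z : cross u v = 1 -> 0 <= inner u v ->
  ~~ in_sector z (u, v) ->
  (cross z v)%:~R * nrm u + (cross u z)%:~R * nrm v < nrm z.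
Proof.
move=> d i0; have h := nrm_mul_gt d i0.
have u0 : 0 < nrm u by apply: (@nrm_gt0 _ v); rewrite d.
have v0 : 0 < nrm v by apply: (@nrm_gt0 _ u); rewrite crossC d.
have := nrm_cross_basis z d.
rewrite /in_sector /= -(@ler0z R (cross u z)) -(@ler0z R (cross z v)).
move: (nrm_ge0 z) (cross z v)%:~R (cross u z)%:~R h.
have : (0 : R) <= (inner u v)%:~R by rewrite ler0z.
move: (inner u v)%:~R (nrm z) (nrm u) (nrm v) u0 v0.
move=> i a b c b0 c0 i0' a0 x y ib e; rewrite negb_and -!ltNge => neg.
rewrite ltNge; apply/negP => am.
have m0 : 0 <= x * b + y * c by apply: le_trans am.
have sq : a ^+ 2 <= (x * b + y * c) ^+ 2 by rewrite ler_sqr ?nnegrE.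
have xy : 0 <= x * y.
  have : x * y * (i - b * c) <= 0.
    have E : (x * b + y * c) ^+ 2 - a ^+ 2 = - (2 * (x * y * (i - b * c))).
      by rewrite e; ring.
    by move: sq; rewrite -subr_ge0 E oppr_ge0 pmulr_rle0.
  by rewrite nmulr_lle0 // subr_lt0.
have neg_sum r s r' s' : 0 < r -> 0 < s -> r' < 0 -> s' <= 0 -> r' * r + s' * s < 0 :> R.
  by move=> r0 s0 r0' s0'; rewrite ltr_wnDr ?pmulr_lle0 // pmulr_llt0.
move: m0; apply/negP; rewrite -ltNge; case/orP: neg => neg.
  by rewrite addrC neg_sum //; move: xy; rewrite nmulr_lge0.
by rewrite neg_sum //; move: xy; rewrite nmulr_rge0.
Qed.

End Norm.
(** * Circumscribed polygons and their interpolation *)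

Section Approximation.
Variable R : realType.
Local Notation plane := 'rV[R]_2.
Implicit Types (x y : plane) (u v z : ivec) (K : set plane) (h k : ivec -> R).

(** Asking for attained maxima keeps compactness out of the geometric part. *)
Definition support_of K k := forall z,
  (forall x, K x -> pairing z x <= k z) /\ exists2 x, K x & pairing z x = k z.

(** The point where the lines [pairing c.1 x = h c.1] and
    [pairing c.2 x = h c.2] meet: the vertex at the cone c of the circumscribed
    polygon with support numbers h. *)
Definition corner (c : sector) h : plane :=
  h c.2 *: rvec R (perp c.1) - h c.1 *: rvec R (perp c.2).

Lemma pairing_corner z c h : pairing z (corner c h) =
  (cross z c.2)%:~R * h c.1 + (cross c.1 z)%:~R * h c.2.
Proof.
rewrite /corner !pairing_lin !pairing_perp (crossC c.2) intrN; ring.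
Qed.

Lemma pairing_corner1 c h : cross c.1 c.2 = 1 -> pairing c.1 (corner c h) = h c.1.
Proof. by move=> d; rewrite pairing_corner d crossvv mul1r mul0r addr0. Qed.

Lemma pairing_corner2 c h : cross c.1 c.2 = 1 -> pairing c.2 (corner c h) = h c.2.
Proof. by move=> d; rewrite pairing_corner d crossvv mul1r mul0r add0r. Qed.

(** Outside the cone of u and v one of the two coefficients of z is negative,
    and sublinearity gives the inequality opposite to the one inside; a point
    maximizing the ray with the other coefficient witnesses it. *)
Lemma support_outside K k u v z : support_of K k -> cross u v = 1 ->
  ~~ in_sector z (u, v) ->
  (cross z v)%:~R * k u + (cross u z)%:~R * k v <= k z.
Proof.
move=> kK d.
have e x : pairing z x = (cross z v)%:~R * pairing u x + (cross u z)%:~R * pairing v x.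
  have [e1 e2] := cross_basis z d.
  by rewrite /pairing [in LHS]e1 [in LHS]e2 !(intrD, intrM); ring.
have [uK [y Ky yu]] := kK u; have [vK [x Kx xv]] := kK v; have [zK _] := kK z.
rewrite /in_sector negb_and -!ltNge /= => /orP[n|n].
  apply: le_trans (zK y Ky); rewrite e yu lerD2l.
  by rewrite ler_wnM2l ?vK // lerz0 ltW.
apply: le_trans (zK x Kx); rewrite e xv lerD2r.
by rewrite ler_wnM2l ?uK // lerz0 ltW.
Qed.

(** The support function of [K + lam B] with B the unit disc. *)
Definition inflate (lam : R) k z := k z + lam * nrm R z.

(** Circumscribing loses nothing: the vertex at one cone satisfies the
    constraints of all rays of the level, strictly except for the two rays of
    that cone, because the inflated support function is strictly convex. *)
Lemma corner_le K k lam q w q' w' z : support_of K k -> 0 < lam ->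
  size w = size w' -> z = (cone q' w').1 \/ z = (cone q' w').2 ->
  let p := pairing z (corner (cone q w) (inflate lam k)) in
  p <= inflate lam k z /\
  (p = inflate lam k z -> z = (cone q w).1 \/ z = (cone q w).2).
Proof.
move=> kK lam0 sw zr p; have d := cross_cone q w.
have [zin|zout] := boolP (in_sector z (cone q w)).
  have zw := ray_in_cone sw zr zin; split=> //.
  by rewrite /p; case: zw => ->; rewrite ?pairing_corner1 ?pairing_corner2.
suff lt : p < inflate lam k z.
  by split; [exact: ltW|move=> e; move: lt; rewrite e ltxx].
have i0 : 0 <= inner (cone q w).1 (cone q w).2 by apply: le_trans (inner_cone q w).
rewrite /p pairing_corner; move: zout; rewrite [cone q w]surjective_pairing /= => zout.
have h1 := support_outside kK d zout.
have := nrm_strict R d i0 zout; rewrite -(ltr_pM2l lam0) /inflate.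
rewrite mulrDr !(mulrCA lam); lra.
Qed.

(** The larger of the two coefficients of x in a cone decides which of the two
    children contains x. *)
Lemma cone_complete n x : exists q w a b, size w = n /\
  [/\ 0 <= a, 0 <= b & x = a *: rvec R (cone q w).1 + b *: rvec R (cone q w).2].
Proof.
elim: n => [|n [q [w [a [b [sw [a0 b0 ->]]]]]]].
  have [x0|x0] := leP 0 (x ord0 0); have [y0|y0] := leP 0 (x ord0 1).
  - exists (true, true), [::], (x ord0 0), (x ord0 1); split=> //; split=> //.
    by apply: planeP; rewrite !mxE /=; ring.
  - exists (false, false), [::], (- x ord0 1), (x ord0 0); split=> //.
    split; rewrite ?oppr_ge0 //; try exact: ltW.
    by apply: planeP; rewrite !mxE /=; ring.
  - exists (true, false), [::], (x ord0 1), (- x ord0 0); split=> //.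
    split; rewrite ?oppr_ge0 //; try exact: ltW.
    by apply: planeP; rewrite !mxE /=; ring.
  - exists (false, true), [::], (- x ord0 0), (- x ord0 1); split=> //.
    split; rewrite ?oppr_ge0 //; try exact: ltW.
    by apply: planeP; rewrite !mxE /=; ring.
have rvecD u v : rvec R (u + v) = rvec R u + rvec R v.
  by apply: planeP; rewrite !mxE /= intrD.
have [ab|ba] := leP b a.
  exists q, (rcons w true), (a - b), b; rewrite size_rcons sw cone_rcons.
  split=> //; split; rewrite ?subr_ge0 //= rvecD.
  by apply: planeP; rewrite !mxE /=; ring.
exists q, (rcons w false), a, (b - a); rewrite size_rcons sw cone_rcons.
split=> //; split; rewrite ?subr_ge0 ?(ltW ba) //= rvecD.
by apply: planeP; rewrite !mxE /=; ring.
Qed.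

Section Level.
Variables (n : nat) (t lam : R) (K : set plane) (k : ivec -> R).
Hypotheses (t0 : 0 < t) (t1 : t <= 1) (lam0 : 0 < lam) (kK : support_of K k).

Let h := inflate lam k.
Let I : Type := (bool * bool * n.+1.-tuple bool)%type.

Definition level_cone (i : bool * bool * n.+1.-tuple bool) := cone i.1 i.2.
Definition parent_cone (i : bool * bool * n.+1.-tuple bool) :=
  cone i.1 (take n i.2).

(** Vertices of the Minkowski segment between the circumscribed polygons of
    levels n and n + 1: the vertex of a sum at a cone is the sum of the vertices
    at the cones containing it. *)
Definition level_vertex (i : bool * bool * n.+1.-tuple bool) : plane :=
  (1 - t) *: corner (parent_cone i) h + t *: corner (level_cone i) h.

Lemma pairing_level z i : pairing z (level_vertex i) =
  (1 - t) * pairing z (corner (parent_cone i) h) +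
  t * pairing z (corner (level_cone i) h).
Proof. by rewrite /level_vertex pairingD 2!pairingZ. Qed.

Lemma level_cone_child i : exists b, level_cone i = child b (parent_cone i).
Proof.
have := size_tuple i.2; rewrite /level_cone /parent_cone.
move: i.1 (tval i.2) => q w sw; exists (last true w).
case/lastP: w sw => [//|w b]; rewrite size_rcons last_rcons => -[<-].
by rewrite -!cats1 take_size_cat // cats1 cone_rcons.
Qed.

Let size_par (i : I) : size (take n i.2) = n.
Proof. by rewrite size_take size_tuple ltnSn. Qed.

(** The coarser polygon has the finer fan as a degenerate normal fan: a new ray
    is a sum of two old ones, and both are maximized at the same vertex. *)
Lemma parent_le i j z : is_ray level_cone j z ->
  pairing z (corner (parent_cone i) h) <= pairing z (corner (parent_cone j) h).
Proof.
have sij : size (take n i.2) = size (take n j.2) by rewrite !size_par.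
have d : cross (parent_cone j).1 (parent_cone j).2 = 1 by exact: cross_cone.
have le1 : pairing (parent_cone j).1 (corner (parent_cone i) h) <=
    pairing (parent_cone j).1 (corner (parent_cone j) h).
  rewrite pairing_corner1 //.
  by have [] := corner_le i.1 (q' := j.1) kK lam0 sij (or_introl erefl).
have le2 : pairing (parent_cone j).2 (corner (parent_cone i) h) <=
    pairing (parent_cone j).2 (corner (parent_cone j) h).
  rewrite pairing_corner2 //.
  by have [] := corner_le i.1 (q' := j.1) kK lam0 sij (or_intror erefl).
have leD u v x y : pairing u x <= pairing u y -> pairing v x <= pairing v y ->
    pairing (u + v) x <= pairing (u + v) y.
  by rewrite /pairing /= !intrD; lra.
have [b e] := level_cone_child j; rewrite /is_ray e.
by case: b {e} => -[->|->] //=; exact: leD.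
Qed.

(** Strictness comes from level n + 1, which has positive weight. *)
Lemma level_vertex_family : smooth_family level_cone level_vertex.
Proof.
have sI (i j : I) : size i.2 = size j.2 by rewrite !size_tuple.
have cI i z : is_ray level_cone i z -> pairing z (corner (level_cone i) h) = h z.
  have d : cross (level_cone i).1 (level_cone i).2 = 1 by exact: cross_cone.
  by move=> [->|->]; rewrite ?pairing_corner1 ?pairing_corner2.
have tup (w : seq bool) : size w = n.+1 -> exists w' : n.+1.-tuple bool, val w' = w.
  by move=> /eqP sw; exists (Tuple sw).
split.
- by move=> i; exact: cross_cone.
- move=> x; have [q [w [a [b [/tup[w' <-] xE]]]]] := cone_complete n.+1 x.
  by exists (q, w'), a, b.
- move=> i; have [q [w [sw e]]] := cone_prev i.1 i.2.
  have [|w' ew] := tup w; first by rewrite sw size_tuple.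
  by exists (q, w'); rewrite /level_cone /= ew.
- move=> i; have [q [w [sw e]]] := cone_next i.1 i.2.
  have [|w' ew] := tup w; first by rewrite sw size_tuple.
  by exists (q, w'); rewrite /level_cone /= ew.
- move=> i j z zj; rewrite !pairing_level (cI j z) //.
  have [le _] := corner_le i.1 kK lam0 (sI i j) zj.
  by rewrite lerD ?ler_wpM2l ?parent_le ?subr_ge0 // ltW.
- move=> i j z zj; rewrite !pairing_level (cI j z) // => e.
  have [le eq] := corner_le i.1 kK lam0 (sI i j) zj.
  apply: eq; apply/le_anti; rewrite le /=.
  rewrite -(ler_pM2l t0).
  have : (1 - t) * pairing z (corner (parent_cone i) h) <=
    (1 - t) * pairing z (corner (parent_cone j) h).
    by rewrite ler_wpM2l ?subr_ge0 // parent_le.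
  by rewrite -/h; move: e; rewrite /level_cone; lra.
Qed.

Lemma sub_level_hull x : K x -> convex_hull (range level_vertex) x.
Proof.
move=> Kx; have fam := level_vertex_family.
have [i0 _] := family_complete fam 0.
rewrite -(halfplanes_hull fam i0) => i; rewrite !pairing_level.
have Kh z : pairing z x <= h z.
  by rewrite ler_wpDr ?(kK z).1 // mulr_ge0 ?nrm_ge0 // ltW.
have d : cross (level_cone i).1 (level_cone i).2 = 1 by exact: cross_cone.
have d' : cross (parent_cone i).1 (parent_cone i).2 = 1 by exact: cross_cone.
rewrite (pairing_corner1 _ d).
suff : pairing (level_cone i).1 x <=
    pairing (level_cone i).1 (corner (parent_cone i) h).
  move=> le; rewrite (_ : pairing _ x = (1 - t) * pairing (level_cone i).1 x +
    t * pairing (level_cone i).1 x); last by ring.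
  by rewrite lerD ?ler_wpM2l ?subr_ge0 // ltW.
have h1 : pairing (parent_cone i).1 x <=
    pairing (parent_cone i).1 (corner (parent_cone i) h) by rewrite pairing_corner1.
have h2 : pairing (parent_cone i).2 x <=
    pairing (parent_cone i).2 (corner (parent_cone i) h) by rewrite pairing_corner2.
have [b ->] := level_cone_child i; case: b => //=.
by move: h1 h2; rewrite /pairing /= !intrD; lra.
Qed.

End Level.

End Approximation.
(** * Distances between convex sets *)

Section Estimates.
Variable R : realType.
Local Notation plane := 'rV[R]_2.
Implicit Types (x y p : plane) (u v z : ivec) (A B K : set plane) (h k : ivec -> R).

Definition thicken (e : R) A : set plane :=
  [set x | exists2 y, A y & euclid_dist x y <= e].

Lemma euclid_dist_ge0 x y : 0 <= euclid_dist x y.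
Proof. exact: sqrtr_ge0. Qed.

Lemma euclid_dist_sq x y : euclid_dist x y ^+ 2 =
  (x ord0 0 - y ord0 0) ^+ 2 + (x ord0 1 - y ord0 1) ^+ 2.
Proof. by rewrite sqr_sqrtr // addr_ge0 ?sqr_ge0. Qed.

Lemma euclid_dist_le x y e : 0 <= e ->
  (x ord0 0 - y ord0 0) ^+ 2 + (x ord0 1 - y ord0 1) ^+ 2 <= e ^+ 2 ->
  euclid_dist x y <= e.
Proof.
move=> e0 h; rewrite -(@ler_pXn2r _ 2%N) ?nnegrE ?euclid_dist_ge0 //.
by rewrite euclid_dist_sq.
Qed.

Lemma euclid_dist_scale (t : R) x x' y : 0 <= t ->
  euclid_dist (t *: x + y) (t *: x' + y) = t * euclid_dist x x'.
Proof.
move=> t0; apply/eqP; rewrite -(@eqrXn2 _ 2%N) ?mulr_ge0 ?euclid_dist_ge0 //.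
by rewrite exprMn !euclid_dist_sq !mxE; apply/eqP; ring.
Qed.

Lemma euclid_dist_mix (t : R) x x' y y' : 0 <= t -> t <= 1 ->
  euclid_dist (t *: x + (1 - t) *: y) (t *: x' + (1 - t) *: y') <=
  t * euclid_dist x x' + (1 - t) * euclid_dist y y'.
Proof.
move=> t0 t1; apply: le_trans (euclid_dist_triangle (t *: x' + (1 - t) *: y) _ _) _.
rewrite euclid_dist_scale // lerD2l ![t *: x' + _]addrC.
by rewrite euclid_dist_scale // subr_ge0.
Qed.

Lemma thicken_convex e A : @convex_set R plane A -> @convex_set R plane (thicken e A).
Proof.
move=> /convex_setP cA; apply/convex_setP => x y t [x' Ax' xx'] [y' Ay' yy'] t0 t1.
exists (t *: x' + (1 - t) *: y'); first exact: cA.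
apply: le_trans (euclid_dist_mix _ _ _ _ t0 t1) _; have : 0 <= 1 - t by rewrite subr_ge0.
nra.
Qed.

(** Moving the generators by at most e moves the hull by at most e, as
    neighbourhoods of convex sets are convex. *)
Lemma hull_within_dist (I : Type) (p p' : I -> plane) e :
  (forall i, euclid_dist (p i) (p' i) <= e) ->
  within_dist e (convex_hull (range p)) (convex_hull (range p')).
Proof.
move=> H; apply: (@smallest_sub _ _ _ (thicken e (convex_hull (range p')))).
  exact: thicken_convex (@convex_hull_convex _ _).
by move=> _ [i _ <-]; exists (p' i) => //; apply: sub_gen_smallest; exists i.
Qed.

Lemma dist_perp_comb u v (a b : R) p :
  euclid_dist (p + a *: rvec R (perp u) + b *: rvec R (perp v)) p ^+ 2 =
  a ^+ 2 * nrm R u ^+ 2 + b ^+ 2 * nrm R v ^+ 2 + 2 * (a * b * (inner u v)%:~R).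
Proof.
rewrite euclid_dist_sq !rvec_perp !nrm_sq /inner !mxE /= !(intrD, intrM).
ring.
Qed.

(** With [a = |c.1|], [b = |c.2|] and [i] their inner product, the displacement has
    square [2 lam^2 ((a b)^2 - a b i)], and [(a b)^2 = i^2 + 1] with [i <= a b]
    bounds the bracket by 1. *)
Lemma corner_nrm c p (lam : R) : cross c.1 c.2 = 1 -> 0 <= inner c.1 c.2 -> 0 <= lam ->
  euclid_dist (p + lam *: corner c (nrm R)) p <= 2 * lam.
Proof.
move=> d i0 lam0.
have -> : p + lam *: corner c (nrm R) = p + (lam * nrm R c.2) *: rvec R (perp c.1)
   + (- lam * nrm R c.1) *: rvec R (perp c.2).
  by apply: planeP; rewrite !mxE; ring.
rewrite -(@ler_pXn2r _ 2%N) ?nnegrE ?euclid_dist_ge0 ?mulr_ge0 //.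
rewrite dist_perp_comb.
have h := nrm_mul_gt R d i0.
have e := nrm_mul_sq R d.
have {}i0 : (0 : R) <= (inner c.1 c.2)%:~R by rewrite ler0z.
move: (inner _ _)%:~R (nrm R c.1) (nrm R c.2) h e i0 => i a b h e i0.
have -> : (lam * b) ^+ 2 * a ^+ 2 + (- lam * a) ^+ 2 * b ^+ 2 +
   2 * (lam * b * (- lam * a) * i) = 2 * (lam ^+ 2 * ((a * b) ^+ 2 - a * b * i)) by ring.
have : (a * b) ^+ 2 - a * b * i <= 1 by rewrite e; nra.
by have := sqr_ge0 lam; rewrite exprMn; nra.
Qed.

(** K touches the two lines through the vertex p at points x and y.  The triangle
    p x y has area [s t / 2] and an angle at p close to a straight one, so its
    height over the side x y is at most the length of that side divided by
    [inner c.1 c.2]. *)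
Lemma corner_near K k c D : @convex_set R plane K -> support_of K k ->
  (forall x y, K x -> K y -> euclid_dist x y <= D) ->
  cross c.1 c.2 = 1 -> 0 < inner c.1 c.2 ->
  thicken (D / (inner c.1 c.2)%:~R) K (corner c k).
Proof.
move=> /convex_setP cK kK HD d i0.
set u := c.1 in d i0 *; set v := c.2 in d i0 *; set p := corner c k.
have [uK [x Kx xu]] := kK u; have [vK [y Ky yv]] := kK v.
set s := k v - pairing v x; set t := k u - pairing u y.
have s0 : 0 <= s by rewrite subr_ge0 vK.
have t0 : 0 <= t by rewrite subr_ge0 uK.
have pu : pairing u p = k u by exact: pairing_corner1.
have pv : pairing v p = k v by exact: pairing_corner2.
have ex : x = p - s *: rvec R (perp u).
  by rewrite /s -pv; apply: on_line; rewrite // pu.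
have ey : y = p + t *: rvec R (perp v).
  have d' : cross v (- u) = 1 by rewrite -d /cross /=; ring.
  have N q : pairing (- u) q = - pairing u q by rewrite /pairing /= !intrN; ring.
  rewrite (on_line d' (etrans yv (esym pv))) !N pu /t.
  by apply: planeP; rewrite !mxE; ring.
have D0 : 0 <= D by apply: le_trans (HD _ _ Kx Kx); exact: euclid_dist_ge0.
have iR : (0 : R) < (inner u v)%:~R by rewrite ltr0z.
have e := nrm_mul_sq R d; rewrite exprMn in e.
have LE : euclid_dist y x ^+ 2 = s ^+ 2 * nrm R u ^+ 2 + t ^+ 2 * nrm R v ^+ 2
    + 2 * (s * t * (inner u v)%:~R).
  rewrite -(dist_perp_comb u v s t x); congr (euclid_dist _ _ ^+ 2).
  by rewrite ey [in RHS]ex; apply: planeP; rewrite !mxE; ring.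
have LD : euclid_dist y x ^+ 2 <= D ^+ 2.
  by rewrite ler_sqr ?nnegrE ?euclid_dist_ge0 // HD.
have U0 : 0 < nrm R u ^+ 2 by rewrite exprn_gt0 // (@nrm_gt0 _ _ v) // d.
have V0 : 0 < nrm R v ^+ 2 by rewrite exprn_gt0 // (@nrm_gt0 _ _ u) // crossC d.
move: (inner u v)%:~R (nrm R u ^+ 2) (nrm R v ^+ 2) (euclid_dist y x ^+ 2)
  (dist_perp_comb u v) iR e LE LD U0 V0 => i U V L comb iR e LE LD U0 V0.
have [st0|st0] := eqVneq (s * t) 0.
  have [s00|t00] : s = 0 \/ t = 0.
    by move/eqP: st0; rewrite mulf_eq0 => /orP[] /eqP; [left|right].
  - by exists x => //; rewrite ex s00 scale0r subr0 euclid_distxx divr_ge0 // ltW.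
  - by exists y => //; rewrite ey t00 scale0r addr0 euclid_distxx divr_ge0 // ltW.
have st : 0 < s * t by rewrite lt_neqAle eq_sym st0 mulr_ge0.
have sU : 0 <= s ^+ 2 * U by rewrite mulr_ge0 ?sqr_ge0 // ltW.
have tV : 0 <= t ^+ 2 * V by rewrite mulr_ge0 ?sqr_ge0 // ltW.
have sti : 0 < s * t * i by rewrite mulr_gt0.
have L0 : 0 < L by rewrite LE; lra.
(* the weight of the foot of the perpendicular from p to the line x y; it lies
   between x and y because the angle at p is obtuse *)
pose th := (t ^+ 2 * V + s * t * i) / L.
have th' : 1 - th = (s ^+ 2 * U + s * t * i) / L.
  by rewrite /th LE; field; rewrite -LE gt_eqF.
have th0 : 0 <= th by rewrite divr_ge0 ?(ltW L0) // addr_ge0 // ltW.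
have th1 : th <= 1.
  by rewrite -subr_ge0 th' divr_ge0 ?(ltW L0) // addr_ge0 // ltW.
exists (th *: x + (1 - th) *: y); first exact: cK.
rewrite euclid_distC.
have -> : th *: x + (1 - th) *: y =
    p + (- (th * s)) *: rvec R (perp u) + ((1 - th) * t) *: rvec R (perp v).
  by rewrite ex ey; apply: planeP; rewrite !mxE; ring.
rewrite -(@ler_pXn2r _ 2%N) ?nnegrE ?euclid_dist_ge0 ?divr_ge0 ?(ltW iR) //.
rewrite comb; have -> : (- (th * s)) ^+ 2 * U + ((1 - th) * t) ^+ 2 * V +
    2 * (- (th * s) * ((1 - th) * t) * i) =
    (s * t) ^+ 2 / L ^+ 2 * (L * (U * V - i ^+ 2)).
  rewrite th' /th; transitivity ((s * t) ^+ 2 / L ^+ 2 *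
    ((s ^+ 2 * U + t ^+ 2 * V + 2 * (s * t * i)) * (U * V - i ^+ 2))).
    by field; rewrite gt_eqF.
  by rewrite -LE.
rewrite e addrAC subrr add0r mulr1.
have -> : (s * t) ^+ 2 / L ^+ 2 * L = (s * t) ^+ 2 / L by field; rewrite gt_eqF.
rewrite ler_pdivrMr // expr_div_n mulrAC ler_pdivlMr ?exprn_gt0 //.
apply: le_trans (_ : L * L <= _); last by rewrite ler_wpM2r // ltW.
rewrite -exprMn -expr2 ler_sqr ?nnegrE ?(ltW L0) ?(ltW sti) //.
by rewrite LE; lra.
Qed.

End Estimates.
(** * Approximation of a convex set by Delzant polygons *)

Section Words.
Variable R : realType.
Local Notation plane := 'rV[R]_2.
Implicit Types (x y p : plane) (u v z : ivec) (A B K : set plane) (h k : ivec -> R).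

Definition clamp (r : R) : R := Num.max 0 (Num.min 1 r).

Lemma clamp_id (r : R) : 0 <= r -> r <= 1 -> clamp r = r.
Proof. by move=> r0 r1; rewrite /clamp (min_idPr r1) (max_idPr r0). Qed.

Lemma clamp_ge1 (r : R) : 1 <= r -> clamp r = 1.
Proof. by move=> r1; rewrite /clamp (min_idPl r1) (max_idPr ler01). Qed.

Lemma clamp_le0 (r : R) : r <= 0 -> clamp r = 0.
Proof.
by move=> r0; rewrite /clamp (min_idPr (le_trans r0 ler01)) (max_idPl r0).
Qed.

(** The broken line through [f 0], [f 1], ... at time tau, written as a sum of
    truncated increments: continuity in tau is then visible, and the value does
    not depend on the cut-off M once [tau <= M]. *)
Definition interp (f : nat -> plane) (tau : R) (M : nat) : plane :=
  f 0%N + \sum_(i < M) clamp (tau - i%:R) *: (f i.+1 - f i).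

Lemma interp_prefix f tau n : n%:R <= tau -> interp f tau n = f n.
Proof.
elim: n => [|n IH] nt; first by rewrite /interp big_ord0 addr0.
have nt' : n%:R <= tau by apply: le_trans nt; rewrite ler_nat.
rewrite /interp big_ord_recr addrA -[X in X + _]/(interp f tau n) IH //=.
by rewrite clamp_ge1 ?scale1r ?lerBrDr ?[_ + n%:R]addrC ?natr1 // addrC subrK.
Qed.

Lemma interpE f tau n M : n%:R < tau -> tau <= n.+1%:R -> (n < M)%N ->
  interp f tau M = (1 - (tau - n%:R)) *: f n + (tau - n%:R) *: f n.+1.
Proof.
move=> nt tn.
have c0 : 0 <= tau - n%:R by rewrite subr_ge0 ltW.
have c1 : tau - n%:R <= 1 by rewrite lerBlDr [_ + n%:R]addrC natr1.
elim: M => // M IH; rewrite ltnS leq_eqVlt => /orP[/eqP <-|nM].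
  rewrite /interp big_ord_recr addrA -[X in X + _]/(interp f tau n).
  rewrite interp_prefix ?(ltW nt) //= clamp_id //.
  by apply: planeP; rewrite !mxE; ring.
rewrite /interp big_ord_recr addrA -[X in X + _]/(interp f tau M) IH //=.
rewrite [clamp _]clamp_le0 ?scale0r ?addr0 // subr_le0 (le_trans tn) //.
by rewrite ler_nat.
Qed.

(** Along a word the vertex moves from the quadrant's corner through the corners
    of ever thinner cones. *)
Definition word_vertex (M : nat) (tau : R) h (i : bool * bool * M.-tuple bool) :=
  interp (fun n => corner (cone i.1 (take n i.2)) h) tau M.

(** The cut-off M makes the index set finite; near a given tau one and the same
    M serves for all values, and [approx_stable] removes it. *)
Definition approx (M : nat) (tau : R) h : set plane :=
  convex_hull (range (@word_vertex M tau h)).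

Lemma word_vertex_level n M tau lam k : n%:R < tau -> tau <= n.+1%:R ->
  (n < M)%N ->
  range (@word_vertex M tau (inflate lam k)) =
  range (@level_vertex R n (tau - n%:R) lam k).
Proof.
move=> nt tn nM; apply/seteqP; split=> [_ [[q w] _ <-]|_ [[q w] _ <-]].
  have sw : size (take n.+1 w) == n.+1 by rewrite size_takel ?size_tuple.
  exists (q, Tuple sw) => //; rewrite /word_vertex (interpE _ nt tn nM).
  by rewrite /level_vertex /parent_cone /level_cone /= take_takel.
have sw : size (w ++ nseq (M - n.+1) false) == M.
  by rewrite size_cat size_tuple size_nseq subnKC.
exists (q, Tuple sw) => //; rewrite /word_vertex (interpE _ nt tn nM).
rewrite /level_vertex /parent_cone /level_cone /=.
by rewrite (take_size_cat _ (size_tuple w)) takel_cat // size_tuple.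
Qed.

(** Intervals closed on the right: at an integer time the interpolation is read
    with full weight on the finer level, so the finer level always has positive
    weight. *)
Lemma between_nat tau : 0 < tau -> exists n, n%:R < tau /\ tau <= n.+1%:R :> R.
Proof.
move=> t0; have ex : exists n, tau <= n%:R.
  by exists (Num.bound tau); rewrite ltW // archi_boundP // ltW.
case: (ex_minnP ex) => -[|n] tn nmin; first by rewrite leNgt t0 in tn.
exists n; split=> //; rewrite ltNge; apply/negP => /nmin.
by rewrite ltnn.
Qed.

Lemma approx_stable M M' tau lam k : 0 < tau -> tau <= M%:R -> tau <= M'%:R ->
  approx M tau (inflate lam k) = approx M' tau (inflate lam k).
Proof.
move=> /between_nat[n [nt tn]] tM tM'; rewrite /approx.
by rewrite !(word_vertex_level _ _ nt tn) // -(ltr_nat R);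
  [exact: lt_le_trans nt tM'|exact: lt_le_trans nt tM].
Qed.

Lemma approx_delzant K k M tau lam : support_of K k -> 0 < lam -> 0 < tau ->
  tau <= M%:R -> is_delzant (approx M tau (inflate lam k)).
Proof.
move=> kK l0 /between_nat[n [nt tn]] tM; rewrite /approx.
rewrite (word_vertex_level _ _ nt tn); last by rewrite -(ltr_nat R) (lt_le_trans nt).
have t0 : 0 < tau - n%:R by rewrite subr_gt0.
have t1 : tau - n%:R <= 1 by rewrite lerBlDr [_ + n%:R]addrC natr1.
exact: smooth_family_delzant (@level_vertex_family R n _ _ _ _ t0 t1 l0 kK).
Qed.

Lemma sub_approx K k M tau lam : support_of K k -> 0 < lam -> 0 < tau ->
  tau <= M%:R -> K `<=` approx M tau (inflate lam k).
Proof.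
move=> kK l0 /between_nat[n [nt tn]] tM x Kx; rewrite /approx.
rewrite (word_vertex_level _ _ nt tn); last by rewrite -(ltr_nat R) (lt_le_trans nt).
have t0 : 0 < tau - n%:R by rewrite subr_gt0.
have t1 : tau - n%:R <= 1 by rewrite lerBlDr [_ + n%:R]addrC natr1.
exact: (@sub_level_hull R n _ _ _ _ t0 t1 l0 kK).
Qed.

Lemma corner_inflate_near K k q w n lam D : @convex_set R plane K ->
  support_of K k -> (forall x y, K x -> K y -> euclid_dist x y <= D) ->
  0 <= lam -> (0 < n)%N -> (n <= size w)%N ->
  thicken (D / n%:R + 2 * lam) K (corner (cone q w) (inflate lam k)).
Proof.
move=> cK kK HD l0 n0 nw; have d := cross_cone q w.
have ni : (n%:Z <= inner (cone q w).1 (cone q w).2).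
  by apply: le_trans (inner_cone q w); rewrite lez_nat.
have i0 : 0 < inner (cone q w).1 (cone q w).2 by apply: lt_le_trans ni; rewrite ltz_nat.
have [y Ky xy] := corner_near cK kK HD d i0; exists y => //.
have -> : corner (cone q w) (inflate lam k) =
    corner (cone q w) k + lam *: corner (cone q w) (nrm R).
  by rewrite /corner /inflate; apply: planeP; rewrite !mxE; ring.
apply: le_trans (euclid_dist_triangle (corner (cone q w) k) _ _) _.
rewrite addrC lerD ?corner_nrm // ?(ltW i0) //.
apply: le_trans xy _; rewrite ler_wpM2l //.
  by apply: le_trans (HD _ _ Ky Ky); rewrite euclid_distxx.
by rewrite lef_pV2 ?posrE ?ltr0n ?ltr0z // -[n%:R]/(n%:Z%:~R) ler_int.
Qed.

(** At time [1 / lam] the levels involved are at least [1 / lam - 1], which is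
    at least [1 / (2 lam)], so the angles contribute at most [2 D lam] and the
    inflation [2 lam]. *)
Lemma approx_near K k M lam D : @convex_set R plane K ->
  support_of K k -> (forall x y, K x -> K y -> euclid_dist x y <= D) ->
  0 < lam -> lam <= 2^-1 -> lam^-1 <= M%:R ->
  approx M lam^-1 (inflate lam k) `<=` thicken ((2 * D + 2) * lam) K.
Proof.
move=> cK kK HD l0 l1 tM.
have t0 : 0 < lam^-1 by rewrite invr_gt0.
have D0 : 0 <= D.
  by have [_ [x Kx _]] := kK 0; apply: le_trans (HD _ _ Kx Kx); rewrite euclid_distxx.
have [n [nt tn]] := between_nat t0; rewrite /approx.
rewrite (word_vertex_level _ _ nt tn); last by rewrite -(ltr_nat R) (lt_le_trans nt).
have t2 : 2 <= lam^-1 by rewrite -[leLHS]invrK lef_pV2 ?posrE ?invr_gt0.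
have n1 : 1 <= n%:R :> R.
  by rewrite ler1n lt0n; apply/eqP => n0; move: tn; rewrite n0; lra.
have n0 : (0 < n)%N by move: n1; rewrite ler1n.
have bound : D / n%:R + 2 * lam <= (2 * D + 2) * lam.
  have -> : (2 * D + 2) * lam = D * (2 * lam) + 2 * lam by ring.
  rewrite lerD2r ler_wpM2l //.
  rewrite -[2 * lam]invrK lef_pV2 ?posrE ?invr_gt0 ?mulr_gt0 ?ltr0n //.
  by rewrite invfM; move: tn; rewrite -natr1; lra.
have thK : @convex_set R plane (thicken ((2 * D + 2) * lam) K) by exact: thicken_convex.
apply: (@smallest_sub _ _ _ (thicken ((2 * D + 2) * lam) K) thK).
move=> _ [[q w] _ <-]; rewrite /level_vertex.
set t := lam^-1 - n%:R.
have near (w' : seq bool) : (n <= size w')%N ->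
    thicken ((2 * D + 2) * lam) K (corner (cone q w') (inflate lam k)).
  move=> nw; have [y Ky xy] := corner_inflate_near q cK kK HD (ltW l0) n0 nw.
  by exists y => //; apply: le_trans bound.
have sw := size_tuple w.
have := (@convex_setP R _).1 thK _ _ (1 - t) (near (take n w) _) (near w _).
rewrite (_ : 1 - (1 - t) = t); last by ring.
apply; rewrite ?size_take ?sw ?leqnSn ?ltnSn //.
  by rewrite subr_ge0 /t lerBlDr [_ + n%:R]addrC natr1.
by rewrite gerBl subr_ge0 ltW.
Qed.

End Words.
(** * Support functions and Minkowski segments of Delzant polygons *)

Section Support.
Variable R : realType.
Local Notation plane := 'rV[R]_2.
Local Notation delzant := (delzant_polygon R).
Implicit Types (x y p : plane) (u v z : ivec) (A B K : set plane) (h k : ivec -> R).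

(** This is the Cauchy-Schwarz inequality. *)
Lemma pairing_lip z x y : pairing z x - pairing z y <= nrm R z * euclid_dist x y.
Proof.
apply: le_trans (ler_norm _) _.
rewrite -(@ler_pXn2r _ 2%N) ?nnegrE ?mulr_ge0 ?nrm_ge0 ?euclid_dist_ge0 //.
rewrite real_normK ?num_real // exprMn nrm_sq euclid_dist_sq /pairing /inner.
rewrite !(intrD, intrM).
move: z.1%:~R z.2%:~R (x ord0 0) (x ord0 1) (y ord0 0) (y ord0 1) => a b c d e f.
by have := sqr_ge0 (a * (d - f) - b * (c - e)); nra.
Qed.

Lemma pairing_continuous z : continuous (pairing z : plane -> R).
Proof.
move=> x; have FF : ProperFilter (nbhs (x : plane)) by exact: nbhs_pfilter.
apply/cvgrPdist_le => e e0.
have N0 : 0 < 2 * nrm R z + 1 by rewrite ltr_wpDl ?mulr_ge0 ?nrm_ge0.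
near=> y.
have xy : `|x - y| <= e / (2 * nrm R z + 1).
  by near: y; apply: cvgr_dist_le; [exact: cvg_id|exact: divr_gt0].
have h : nrm R z * euclid_dist x y <= e.
  apply: (le_trans (ler_wpM2l (nrm_ge0 R z) (euclid_dist_le_norm x y))).
  rewrite ler_pdivlMr // in xy.
  by have := normr_ge0 (x - y); lra.
by rewrite ler_norml lerNl opprB !(le_trans (pairing_lip _ _ _)) // euclid_distC.
Unshelve. all: by end_near. Qed.

Definition supp A z : R := sup [set pairing z x | x in A].

Lemma supp_support_of A : A !=set0 -> compact A -> support_of A (supp A).
Proof.
move=> A0 cA z.
have [|c /[!inE] Ac cmax] := @compact_EVT_max plane R (pairing z) A A0 cA.
  exact: (continuous_subspaceT (@pairing_continuous z)).
have {}cmax x : A x -> pairing z x <= pairing z c by move=> Ax; apply: cmax; rewrite inE.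
have ub : ubound [set pairing z x | x in A] (pairing z c) by move=> _ [x Ax <-]; exact: cmax.
have e : supp A z = pairing z c.
  apply/le_anti; rewrite ge_sup //=; last by exists (pairing z c), c.
  by apply: ub_le_sup; [exists (pairing z c)|exists c].
by rewrite e; split=> //; exists c.
Qed.

Lemma supp_lip A B kA kB e z : support_of A kA -> support_of B kB ->
  within_dist e A B -> kA z - kB z <= nrm R z * e.
Proof.
move=> sA sB AB; have [_ [x Ax <-]] := sA z; have [y By xy] := AB x Ax.
have [zB _] := sB z; have := zB y By; have := pairing_lip z x y.
by have := ler_wpM2l (nrm_ge0 R z) xy; lra.
Qed.

(** The Minkowski segment from A to B at time s. *)
Definition mix_set (s : R) A B : set plane :=
  [set z | exists2 x, A x & exists2 y, B y & z = (1 - s) *: x + s *: y].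

Definition mix (s : R) (k k' : ivec -> R) z : R := (1 - s) * k z + s * k' z.

Lemma mix_support_of s A B k k' : 0 <= s -> s <= 1 -> support_of A k ->
  support_of B k' -> support_of (mix_set s A B) (mix s k k').
Proof.
move=> s0 s1 kA kB z; have [zA [a Aa az]] := kA z; have [zB [b Bb bz]] := kB z.
have s1' : 0 <= 1 - s by rewrite subr_ge0.
split=> [_ [x Ax [y By ->]]|].
  by rewrite pairingD !pairingZ lerD // ler_wpM2l ?zA ?zB.
exists ((1 - s) *: a + s *: b); first by exists a => //; exists b.
by rewrite pairingD !pairingZ az bz.
Qed.

Lemma mix_set_convex s A B : @convex_set R plane A -> @convex_set R plane B ->
  @convex_set R plane (mix_set s A B).
Proof.
move=> /convex_setP cA /convex_setP cB.
apply/convex_setP => _ _ t [x Ax [y By ->]] [x' Ax' [y' By' ->]] t0 t1.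
exists (t *: x + (1 - t) *: x'); first exact: cA.
exists (t *: y + (1 - t) *: y'); first exact: cB.
by apply: planeP; rewrite !mxE; ring.
Qed.

Lemma euclid_dist_comb (s : R) x x' y y' : 0 <= s -> s <= 1 ->
  euclid_dist ((1 - s) *: x + s *: y) ((1 - s) *: x' + s *: y') <=
  (1 - s) * euclid_dist x x' + s * euclid_dist y y'.
Proof.
move=> s0 s1; have := @euclid_dist_mix R (1 - s) x x' y y'.
by rewrite subKr; apply; [rewrite subr_ge0|rewrite gerBl].
Qed.

Lemma mix_set_diam s A B D : 0 <= s -> s <= 1 ->
  (forall x y, A x -> A y -> euclid_dist x y <= D) ->
  (forall x y, B x -> B y -> euclid_dist x y <= D) ->
  forall x y, mix_set s A B x -> mix_set s A B y -> euclid_dist x y <= D.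
Proof.
move=> s0 s1 hA hB _ _ [x Ax [y By ->]] [x' Ax' [y' By' ->]].
apply: le_trans (euclid_dist_comb _ _ _ _ s0 s1) _.
have s1' : 0 <= 1 - s by rewrite subr_ge0.
by have := ler_wpM2l s0 (hB _ _ By By'); have := ler_wpM2l s1' (hA _ _ Ax Ax'); lra.
Qed.

(** Moving s costs [|s - s'|] times the distances between A and B, moving A costs
    at most d. *)
Lemma mix_set_within s s' A A' B d D : 0 <= s' -> s' <= 1 -> 0 <= d -> 0 <= D ->
  within_dist d A A' -> (forall x y, A x -> B y -> euclid_dist x y <= D) ->
  `|s - s'| <= d -> within_dist (d + d * D) (mix_set s A B) (mix_set s' A' B).
Proof.
move=> s0 s1 d0 D0 AA' AB ss' _ [x Ax [y By ->]]; have [x' Ax' xx'] := AA' x Ax.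
exists ((1 - s') *: x' + s' *: y); first by exists x' => //; exists y.
apply: le_trans (euclid_dist_triangle ((1 - s') *: x + s' *: y) _ _) _.
have -> : euclid_dist ((1 - s) *: x + s *: y) ((1 - s') *: x + s' *: y) =
    `|s - s'| * euclid_dist x y.
  apply/eqP; rewrite -(@eqrXn2 _ 2%N) ?mulr_ge0 ?euclid_dist_ge0 //.
  rewrite exprMn real_normK ?num_real // !euclid_dist_sq !mxE; apply/eqP; ring.
rewrite addrC lerD //.
  apply: le_trans (euclid_dist_comb _ _ _ _ s0 s1) _.
  rewrite euclid_distxx mulr0 addr0 -[leRHS]mul1r ler_pM ?euclid_dist_ge0 //.
    by rewrite subr_ge0.
  by rewrite gerBl.
by rewrite ler_pM ?euclid_dist_ge0 ?AB.
Qed.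

Lemma delzant_convex (P : delzant) : @convex_set R plane P.
Proof.
by case: (polygon_setP P) => [[V _ ->] _ _ _]; exact: convex_hull_convex.
Qed.

Lemma delzant_support (P : delzant) : support_of P (supp P).
Proof. exact: supp_support_of (delzant_nonempty P) (@delzant_compact _ P). Qed.

Lemma delzant_diam (P Q : delzant) : exists D,
  forall x y, (P : set plane) x -> (Q : set plane) y -> euclid_dist x y <= D.
Proof.
have bnd P' : exists M : R, forall x, (polygon_set P') x -> `|x| <= M.
  have [M [_ HM]] := compact_bounded (@delzant_compact R P').
  by exists (M + 1) => x; apply: HM; rewrite ltrDl.
have [M HM] := bnd P; have [N HN] := bnd Q; exists (2 * (M + N)) => x y Px Qy.
apply: le_trans (euclid_dist_le_norm _ _) _.
by rewrite ler_pM2l // (le_trans (ler_normB _ _)) // lerD ?HM ?HN.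
Qed.

Lemma delzant_eq (P Q : delzant) : P = Q :> set plane -> P = Q.
Proof.
case: P Q => [A HA] [B HB] /= AB; case: _ / AB HB => HB.
by congr DelzantPolygon; exact: Prop_irrelevance.
Qed.

Lemma mdist_le (P Q : delzant) e : 0 <= e ->
  within_dist e (polygon_set P) (polygon_set Q) ->
  within_dist e (polygon_set Q) (polygon_set P) -> mdist P Q <= e.
Proof. by move=> e0 PQ QP; apply: ge_inf => //; exists 0 => d []. Qed.

Lemma mdist_lt_within (P Q : delzant) e : mdist P Q < e ->
  within_dist e (polygon_set P) (polygon_set Q) /\
  within_dist e (polygon_set Q) (polygon_set P).
Proof.
have [D HD] := delzant_diam P Q.
move=> /inf_lt[|d [d0 PQ QP] /ltW de].
  have [[x Px] [y Qy]] := (delzant_nonempty P, delzant_nonempty Q).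
  exists D; split; first by apply: le_trans (HD _ _ Px Qy); exact: euclid_dist_ge0.
  - by move=> x' Px'; exists y => //; exact: HD.
  - by move=> y' Qy'; exists x => //; rewrite euclid_distC; exact: HD.
split=> x; first by move=> /PQ[y Qy xy]; exists y => //; exact: le_trans de.
by move=> /QP[y Qy xy]; exists y => //; exact: le_trans de.
Qed.

Lemma within_dist_trans e e' A B K : within_dist e A B -> within_dist e' B K ->
  within_dist (e + e') A K.
Proof.
move=> AB BK x /AB[y /BK[z Kz yz] xy]; exists z => //.
by apply: le_trans (euclid_dist_triangle y _ _) _; rewrite lerD.
Qed.

Lemma sub_within_dist e A B : 0 <= e -> A `<=` B -> within_dist e A B.
Proof. by move=> e0 AB x /AB Bx; exists x; rewrite // euclid_distxx. Qed.

Lemma within_dist_le e e' A B : e <= e' -> within_dist e A B -> within_dist e' A B.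
Proof. by move=> ee' AB x /AB[y By xy]; exists y => //; exact: le_trans ee'. Qed.

End Support.
(** * Continuity of the vertices *)

Section WordContinuity.
Variable R : realType.
Local Notation plane := 'rV[R]_2.

Lemma clamp_continuous : continuous (@clamp R : R -> R).
Proof.
move=> r; apply: (@continuous_max R R (cst 0) (fun r => Num.min 1 r)).
  exact: cvg_cst.
apply: (@continuous_min R R (cst 1) id); first exact: cvg_cst.
exact: cvg_id.
Qed.

Section Filter.
Variables (T : Type) (F : set_system T).
Context {FF : Filter F}.

Lemma interp_cvg (f : T -> nat -> plane) (f0 : nat -> plane) (tau : T -> R) tau0 M j :
  (forall n, f t n ord0 j @[t --> F] --> f0 n ord0 j) -> tau t @[t --> F] --> tau0 ->
  interp (f t) (tau t) M ord0 j @[t --> F] --> interp f0 tau0 M ord0 j.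
Proof.
move=> cf ct; elim: M => [|M IH].
  rewrite /interp big_ord0 addr0.
  by under eq_fun do rewrite big_ord0 addr0; exact: cf.
have S g r : interp g r M.+1 ord0 j = interp g r M ord0 j +
    clamp (r - M%:R) * (g M.+1 ord0 j - g M ord0 j).
  by rewrite /interp big_ord_recr addrA !mxE.
rewrite S; under eq_fun do rewrite S.
apply: (@cvgD _ R^o) => //; apply: cvgM; last by apply: (@cvgB _ R^o).
have cd : tau t - M%:R @[t --> F] --> tau0 - M%:R.
  by apply: (@cvgB _ R^o) => //; exact: cvg_cst.
exact: (cvg_comp _ _ cd (@clamp_continuous (tau0 - M%:R))).
Qed.

Lemma word_vertex_cvg (h : T -> ivec -> R) h0 (tau : T -> R) tau0 M i j :
  (forall z, h t z @[t --> F] --> h0 z) -> tau t @[t --> F] --> tau0 ->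
  @word_vertex R M (tau t) (h t) i ord0 j @[t --> F] -->
  @word_vertex R M tau0 h0 i ord0 j.
Proof.
move=> ch ct; apply: interp_cvg => // n; set c := cone _ _.
rewrite /corner !mxE; under eq_fun do rewrite !mxE.
by apply: (@cvgB _ R^o); apply: cvgM => //; exact: cvg_cst.
Qed.

End Filter.
End WordContinuity.
(** * The contraction *)

Section Retraction.
Variables (R : realType) (P0 : delzant_polygon R).
Local Notation plane := 'rV[R]_2.
Local Notation delzant := (delzant_polygon R).
Local Notation I := (unit_interval R).
Implicit Types (P Q : delzant) (s : R).

(** The inflation at time s.  The factors s and 1 - s make the deformation start
    at P and end at P0; the factor [mdist P P0] keeps P0 fixed throughout. *)
Definition radius P s : R := s * (1 - s) * mdist P P0.

Definition mix_supp P s : ivec -> R := mix s (supp P) (supp P0).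

Definition rounded_mix M P s : set plane :=
  approx M (radius P s)^-1 (inflate (radius P s) (mix_supp P s)).

Definition contraction_set P s : set plane :=
  if 0 < radius P s then rounded_mix (Num.bound (radius P s)^-1) P s
  else mix_set s P P0.

Lemma radius_ge0 P s : 0 <= s -> s <= 1 -> 0 <= radius P s.
Proof. by move=> s0 s1; rewrite !mulr_ge0 ?mdist_ge0 // subr_ge0. Qed.

Lemma mix_set0 P : mix_set 0 P P0 = P.
Proof.
have [y0 Py0] := delzant_nonempty P0.
apply/seteqP; split=> [_ [x Px [y _ ->]]|x Px].
  by rewrite subr0 scale1r scale0r addr0.
by exists x => //; exists y0 => //; rewrite subr0 scale1r scale0r addr0.
Qed.

Lemma mix_set1 P : mix_set 1 P P0 = P0.
Proof.
have [x0 Px0] := delzant_nonempty P.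
apply/seteqP; split=> [_ [x _ [y Py ->]]|y Py].
  by rewrite subrr scale1r scale0r add0r.
by exists x0 => //; exists y => //; rewrite subrr scale1r scale0r add0r.
Qed.

Lemma mix_set_self s : 0 <= s -> s <= 1 -> mix_set s P0 P0 = P0.
Proof.
move=> s0 s1; apply/seteqP; split=> [_ [x Px [y Py ->]]|x Px].
  have := (convex_setP _).1 (@delzant_convex R P0) x y (1 - s) Px Py.
  by rewrite subKr; apply; [rewrite subr_ge0|rewrite gerBl].
by exists x => //; exists x => //; rewrite -scalerDl subrK scale1r.
Qed.

Lemma contraction_set0 P : contraction_set P 0 = P.
Proof. by rewrite /contraction_set /radius !mul0r ltxx mix_set0. Qed.

Lemma contraction_set1 P : contraction_set P 1 = P0.
Proof. by rewrite /contraction_set /radius subrr mulr0 mul0r ltxx mix_set1. Qed.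

Lemma contraction_set_self s : 0 <= s -> s <= 1 -> contraction_set P0 s = P0.
Proof.
by move=> s0 s1; rewrite /contraction_set /radius mdistxx mulr0 ltxx mix_set_self.
Qed.

Lemma mix_supp_support P s : 0 <= s -> s <= 1 ->
  support_of (mix_set s P P0) (mix_supp P s).
Proof. by move=> s0 s1; apply: mix_support_of => //; exact: delzant_support. Qed.

Lemma rounded_stable M P s : 0 < radius P s -> (radius P s)^-1 <= M%:R ->
  contraction_set P s = rounded_mix M P s.
Proof.
move=> w0 wM; rewrite /contraction_set w0; apply: approx_stable => //.
  by rewrite invr_gt0.
by rewrite ltW // archi_boundP // invr_ge0 ltW.
Qed.

(** Where the radius vanishes the Minkowski segment is P or P0 itself. *)
Lemma contraction_set_delzant P s : 0 <= s -> s <= 1 ->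
  is_delzant (contraction_set P s).
Proof.
move=> s0 s1; have [w0|w0] := boolP (0 < radius P s).
  have wM : (radius P s)^-1 <= (Num.bound (radius P s)^-1)%:R.
    by rewrite ltW // archi_boundP // invr_ge0 ltW.
  rewrite (rounded_stable w0 wM).
  have i0 : 0 < (radius P s)^-1 by rewrite invr_gt0.
  exact: approx_delzant (mix_supp_support P s0 s1) w0 i0 wM.
have : radius P s = 0 by apply/le_anti; rewrite radius_ge0 // leNgt w0.
move=> /eqP; rewrite /radius !mulf_eq0 subr_eq0 -orbA => /or3P[/eqP->|/eqP<-|/eqP].
- by rewrite contraction_set0; exact: polygon_setP.
- by rewrite contraction_set1; exact: polygon_setP.
- by move=> /mdist_positivity ->; rewrite contraction_set_self //; exact: polygon_setP.
Qed.

Lemma unit_interval_bounds (t : I) : 0 <= set_val t <= 1.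
Proof. by have := set_valP t; rewrite /= in_itv. Qed.

Definition contraction (Pt : delzant * I) : delzant :=
  DelzantPolygon (contraction_set_delzant Pt.1
    (andP (unit_interval_bounds Pt.2)).1 (andP (unit_interval_bounds Pt.2)).2).

Lemma supp_cvg P z : (fun Q : delzant => supp Q z) @ nbhs P --> supp P z.
Proof.
apply/cvgrPdist_le => e e0.
have N0 : 0 < nrm R z + 1 by rewrite ltr_wpDl ?nrm_ge0.
near=> Q.
have : mdist P Q < e / (nrm R z + 1).
  near: Q; apply: (@filterS _ _ _ (ball P (e / (nrm R z + 1)))).
    by move=> Q; rewrite ballEmdist.
  by apply: nbhsx_ballx; exact: divr_gt0.
move=> /mdist_lt_within[PQ QP].
have h : nrm R z * (e / (nrm R z + 1)) <= e.
  by rewrite mulrCA ler_piMr ?(ltW e0) // ler_pdivrMr // mul1r lerDl.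
have h1 := supp_lip z (delzant_support P) (delzant_support Q) PQ.
have h2 := supp_lip z (delzant_support Q) (delzant_support P) QP.
by rewrite ler_norml; lra.
Unshelve. all: by end_near. Qed.

Lemma mdist_cvg P : (fun Q : delzant => mdist Q P0) @ nbhs P --> mdist P P0.
Proof.
apply/cvgrPdist_le => e e0; near=> Q.
have PQ : mdist P Q < e.
  near: Q; apply: (@filterS _ _ _ (ball P e)); last exact: nbhsx_ballx.
  by move=> Q; rewrite ballEmdist.
have h1 := metric_triangle P Q P0; have h2 := metric_triangle Q P P0.
have h3 := metric_sym P Q.
by rewrite ler_norml; lra.
Unshelve. all: by end_near. Qed.

Section At.
Variables (P : delzant) (t : I).
Let s := set_val t.
Let F := nbhs ((P, t) : delzant * I).

Let par_cvg : (fun x : delzant * I => set_val x.2 : R) @ F --> s.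
Proof.
have h1 : (fun x : delzant * I => x.2) @ F --> t by exact: cvg_snd.
have h2 : (fun u : I => set_val u : R) @ nbhs t --> s by exact: initial_continuous.
exact: (cvg_comp _ _ h1 h2).
Qed.

Let supp_cvg' z : (fun x : delzant * I => supp x.1 z) @ F --> supp P z.
Proof.
have h1 : (fun x : delzant * I => x.1) @ F --> P by exact: cvg_fst.
exact: (cvg_comp _ _ h1 (@supp_cvg P z)).
Qed.

Lemma radius_cvg : (fun x : delzant * I => radius x.1 (set_val x.2)) @ F --> radius P s.
Proof.
have h1 : (fun x : delzant * I => x.1) @ F --> P by exact: cvg_fst.
apply: cvgM; last exact: (cvg_comp _ _ h1 (@mdist_cvg P)).
by apply: cvgM => //; apply: (@cvgB _ R^o) => //; exact: cvg_cst.
Qed.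

Lemma mix_supp_cvg z :
  (fun x : delzant * I => mix_supp x.1 (set_val x.2) z) @ F --> mix_supp P s z.
Proof.
apply: (@cvgD _ R^o); apply: cvgM => //; last exact: cvg_cst.
by apply: (@cvgB _ R^o) => //; exact: cvg_cst.
Qed.

Lemma rounded_vertex_cvg M i j : 0 < radius P s ->
  (fun x : delzant * I => @word_vertex R M (radius x.1 (set_val x.2))^-1
     (inflate (radius x.1 (set_val x.2)) (mix_supp x.1 (set_val x.2))) i ord0 j) @ F
  --> @word_vertex R M (radius P s)^-1 (inflate (radius P s) (mix_supp P s)) i ord0 j.
Proof.
move=> w0; apply: word_vertex_cvg; last first.
  by apply: cvgV; [rewrite gt_eqF|exact: radius_cvg].
move=> z; apply: (@cvgD _ R^o); first exact: mix_supp_cvg.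
by apply: cvgM; [exact: radius_cvg|exact: cvg_cst].
Qed.

(** Near a point of positive radius one cut-off M works, so the polygons are hulls
    of finitely many points that depend continuously on the parameters. *)
Lemma contraction_cvg_interior : 0 < radius P s ->
  contraction x @[x --> F] --> contraction (P, t).
Proof.
move=> w0; have iw0 : 0 <= (radius P s)^-1 by rewrite invr_ge0 ltW.
set M := Num.bound (radius P s)^-1.
have wM : (radius P s)^-1 < M%:R by exact: archi_boundP.
have cV : (fun x : delzant * I => (radius x.1 (set_val x.2))^-1) @ F --> (radius P s)^-1.
  by apply: cvgV; [rewrite gt_eqF|exact: radius_cvg].
apply/cvg_ballP => e e0.
have e4 : 0 < e / 4 by exact: divr_gt0.
near=> x.
have w0' : 0 < radius x.1 (set_val x.2).
  by near: x; exact: (cvgr_gt _ radius_cvg).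
have wM' : (radius x.1 (set_val x.2))^-1 < M%:R.
  by near: x; exact: (cvgr_lt _ cV).
rewrite ballEmdist /=; apply: (@le_lt_trans _ _ (e / 2)); last first.
  by rewrite ltr_pdivrMr // ltr_pMr // ltr1n.
pose V (y : delzant * I) := @word_vertex R M (radius y.1 (set_val y.2))^-1
     (inflate (radius y.1 (set_val y.2)) (mix_supp y.1 (set_val y.2))).
have Vx i j : `|V (P, t) i ord0 j - V x i ord0 j| <= e / 4.
  move: i j; near: x; apply: filter_forall => i; apply: filter_forall => j.
  have /cvgrPdist_le/(_ _ e4) := @rounded_vertex_cvg M i j w0.
  by [].
have dV i : euclid_dist (V (P, t) i) (V x i) <= e / 2.
  apply: euclid_dist_le; first by rewrite divr_ge0 // ltW.
  have sq j : (V (P, t) i ord0 j - V x i ord0 j) ^+ 2 <= (e / 4) ^+ 2.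
    by rewrite -[leLHS]real_normK ?num_real // ler_sqr ?nnegrE ?(ltW e4).
  apply: le_trans (lerD (sq 0) (sq 1)) _.
  have -> : (e / 2) ^+ 2 = 4 * (e / 4) ^+ 2 by field.
  by move: (sqr_ge0 (e / 4)); move: ((e / 4) ^+ 2) => a a0; lra.
have EP : polygon_set (contraction (P, t)) = convex_hull (range (V (P, t))).
  exact: (rounded_stable w0 (ltW wM)).
have Ex : polygon_set (contraction x) = convex_hull (range (V x)).
  exact: (rounded_stable w0' (ltW wM')).
apply: mdist_le; first by rewrite divr_ge0 // ltW.
  by rewrite EP Ex; exact: hull_within_dist.
rewrite EP Ex; apply: hull_within_dist => i; by rewrite euclid_distC.
Unshelve. all: by end_near. Qed.

(** Where the radius vanishes, nearby polygons are within a multiple of their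
    radius of their Minkowski segments, uniformly since the diameters stay
    bounded, and the Minkowski segments are close to each other. *)
Lemma contraction_cvg_boundary : radius P s = 0 ->
  contraction x @[x --> F] --> contraction (P, t).
Proof.
move=> w0; have /andP[s0 s1] := unit_interval_bounds t.
have [D1 HD1] := delzant_diam P P; have [D2 HD2] := delzant_diam P P0.
have [D3 HD3] := delzant_diam P0 P0.
pose D := `|D1| + `|D2| + `|D3| + 2.
have [n1 n2 n3] : [/\ 0 <= `|D1|, 0 <= `|D2| & 0 <= `|D3|] by [].
have [l1 l2 l3] : [/\ D1 <= `|D1|, D2 <= `|D2| & D3 <= `|D3|] by rewrite !ler_norm.
have D0 : 0 <= D by rewrite /D; lra.
apply/cvg_ballP => e e0.
pose d := Num.min 2^-1 (e / (2 * (3 * D + 3))).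
have c0 : 0 < 2 * (3 * D + 3) by lra.
have d0 : 0 < d by rewrite /d lt_min invr_gt0 ltr0n divr_gt0.
have d2 : d <= 2^-1 by rewrite /d ge_min lexx.
have de : d * (2 * (3 * D + 3)) <= e by rewrite -ler_pdivlMr // /d ge_min lexx orbT.
suff main Q (u : I) : mdist P Q < d -> `|s - set_val u| <= d ->
    radius Q (set_val u) <= d -> mdist (contraction (P, t)) (contraction (Q, u)) < e.
  near=> x.
  rewrite [x in ball _ _ (contraction x)]surjective_pairing ballEmdist /=; apply: main.
  - near: x; have : (fun x : delzant * I => x.1) @ F --> P by exact: cvg_fst.
    by move=> /cvg_ballP/(_ _ d0); apply: filterS => y; rewrite ballEmdist.
  - by near: x; have /cvgrPdist_le/(_ _ d0) := par_cvg.
  - by near: x; apply: (cvgr_le _ radius_cvg); rewrite w0.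
move=> PQ ss wd.
have /andP[u0 u1] := unit_interval_bounds u; set s' := set_val u in ss wd u0 u1 *.
have [wPQ wQP] := mdist_lt_within PQ.
have DQ0 x y : (Q : set plane) x -> (P0 : set plane) y -> euclid_dist x y <= D.
  move=> /wQP[x' Px' xx'] Py; apply: le_trans (euclid_dist_triangle x' _ _) _.
  by have := HD2 _ _ Px' Py; rewrite /D; lra.
have DQ x y : (Q : set plane) x -> (Q : set plane) y -> euclid_dist x y <= D.
  move=> /wQP[x' Px' xx'] /wQP[y' Py' yy'].
  apply: le_trans (euclid_dist_triangle x' _ _) _.
  have := euclid_dist_triangle y' x' y; rewrite (euclid_distC y' y).
  by have := HD1 _ _ Px' Py'; rewrite /D; lra.
have DP x y : (P : set plane) x -> (P0 : set plane) y -> euclid_dist x y <= D.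
  by move=> Px Py; have := HD2 _ _ Px Py; rewrite /D; lra.
have D00 x y : (P0 : set plane) x -> (P0 : set plane) y -> euclid_dist x y <= D.
  by move=> Px Py; have := HD3 _ _ Px Py; rewrite /D; lra.
have KK' : within_dist (d + d * D) (mix_set s P P0) (mix_set s' Q P0).
  by apply: mix_set_within => //; exact: ltW.
have K'K : within_dist (d + d * D) (mix_set s' Q P0) (mix_set s P P0).
  by apply: mix_set_within => //; [exact: ltW|rewrite distrC].
have EP : polygon_set (contraction (P, t)) = mix_set s P P0.
  by rewrite /= /contraction_set -/s w0 ltxx.
pose r := (2 * D + 2) * d.
have r0 : 0 <= r by rewrite /r mulr_ge0 ?(ltW d0) //; lra.
have [SK KS] : within_dist r (polygon_set (contraction (Q, u))) (mix_set s' Q P0) /\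
    within_dist r (mix_set s' Q P0) (polygon_set (contraction (Q, u))).
  rewrite /= -/s'; have [wp|wn] := boolP (0 < radius Q s'); last first.
    by rewrite /contraction_set (negbTE wn); split; exact: sub_within_dist.
  have iw : 0 < (radius Q s')^-1 by rewrite invr_gt0.
  have wM : (radius Q s')^-1 <= (Num.bound (radius Q s')^-1)%:R.
    by rewrite ltW // archi_boundP // ltW.
  have spt := mix_supp_support Q u0 u1.
  rewrite (rounded_stable wp wM); split; last first.
    by apply: sub_within_dist => //; exact: sub_approx spt wp iw wM.
  have cK : @convex_set R plane (mix_set s' Q P0).
    by apply: mix_set_convex; exact: delzant_convex.
  have dK := mix_set_diam u0 u1 DQ D00.
  have nr := approx_near cK spt dK wp (le_trans wd d2) wM.
  apply: within_dist_le nr.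
  by rewrite /r; apply: ler_wpM2l => //; lra.
apply: (@le_lt_trans _ _ (d + d * D + r)).
  apply: mdist_le; first by have := mulr_ge0 (ltW d0) D0; lra.
    by rewrite EP; exact: within_dist_trans KK' KS.
  by rewrite EP addrC; exact: within_dist_trans SK K'K.
by rewrite /r; lra.
Unshelve. all: by end_near. Qed.

End At.

Lemma contraction_continuous : continuous contraction.
Proof.
move=> [P t]; have /andP[s0 s1] := unit_interval_bounds t.
have [w0|w0] := boolP (0 < radius P (set_val t)); first exact: contraction_cvg_interior.
apply: contraction_cvg_boundary.
by apply/le_anti; rewrite radius_ge0 // leNgt w0.
Qed.

Lemma contraction_zero P : contraction (P, zero) = P.
Proof. by apply: delzant_eq => /=; exact: contraction_set0. Qed.

Lemma contraction_one P : contraction (P, one) = P0.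
Proof. by apply: delzant_eq => /=; exact: contraction_set1. Qed.

Lemma contraction_base (t : I) : contraction (P0, t) = P0.
Proof.
have /andP[s0 s1] := unit_interval_bounds t.
by apply: delzant_eq; exact: contraction_set_self.
Qed.

End Retraction.

(** The approximation of a single point, at inflation 1. *)
Lemma delzant_polygon_exists (R : realType) : inhabited (delzant_polygon R).
Proof.
have k0 : support_of [set 0] (fun=> 0 : R).
  have p0 z : pairing z (0 : 'rV[R]_2) = 0 by rewrite /pairing !mxE !mulr0 addr0.
  by move=> z; split=> [x ->|]; [rewrite p0|exists 0].
have := @approx_delzant R _ _ 1%N 1 1 k0 ltr01 ltr01 (lexx _).
by move=> H; constructor; exact: DelzantPolygon H.
Qed.

(** The contraction onto the base point is a homotopy from any loop to the constant
    one, and its end points stay put because the base point is fixed. *)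
Theorem corollary3p45 (R : realType) :
  simply_connected R (delzant_polygon R).
Proof.
pose D := delzant_polygon R; pose I := unit_interval R.
have C (P0 : D) := @contraction_continuous R P0.
split.
  have [Q] := delzant_polygon_exists R.
  split=> [|P P0]; first by exists Q.
  have cf : continuous (fun t : I => contraction P0 (P, t)).
    move=> t; have h1 : (fun u : I => P) @ nbhs t --> P by exact: cvg_cst.
    have h2 : (fun u : I => u) @ nbhs t --> t by exact: cvg_id.
    exact: (cvg_comp _ _ (cvg_pair h1 h2) (C P0 (P, t))).
  by constructor; exact: (mk_path cf (contraction_zero P0 P) (contraction_one P0 P)).
move=> P0 f; exists (fun st : I * I => contraction P0 (f st.1, st.2)); split.
- move=> [s t].
  have h1 : (fun st : I * I => st.1) @ nbhs (s, t) --> s by exact: cvg_fst.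
  have h2 : (fun st : I * I => st.2) @ nbhs (s, t) --> t by exact: cvg_snd.
  have h3 : (fun st : I * I => f st.1) @ nbhs (s, t) --> f s.
    exact: (cvg_comp _ _ h1 (@cts_fun _ _ f s)).
  exact: (cvg_comp _ _ (cvg_pair h3 h2) (C P0 (f s, t))).
- by move=> s /=; exact: contraction_zero.
- by move=> s /=; exact: contraction_one.
- by move=> t /=; rewrite path_zero path_one contraction_base.
Qed.
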